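(* Let $K$ be a Henselian valued field with nontrivial valuation, and let $D$ be a noncommutative tame finite-dimensional central division algebra over $K$. Then the multiplicative group $D^*=D\setminus\{0\}$ contains no locally nilpotent maximal subgroup.
   Context: A valuation on a division ring $D$ is a function $v:D\to\Gamma\cup\{\infty\}$, where $\Gamma$ is a totally ordered additive abelian group and $\infty$ is larger than every element of $\Gamma$ and absorbing for addition, such that for all $x,y\in D$: $v(x)=\infty$ iff $x=0$; $v(x+y)\ge\min\{v(x),v(y)\}$; $v(xy)=v(x)+v(y)$. Its value group is $\Gamma_D=v(D^* )$. The valuation is nontrivial if it takes a nonzero value on some nonzero element. A valued field $(K,v)$ is Henselian if $v$ extends uniquely to every algebraic extension of $K$; in that case $v$ extends uniquely to a valuation on every finite-dimensional central division algebra $D$ over $K$ (i.e. $Z(D)=K$ and $[D:K]<\infty$), and $D$ is always considered with this valuation. For $\gamma\in\Gamma_D$ put $D^{\ge\gamma}=\{d\in D: v(d)\ge\gamma\}$ and $D^{>\gamma}=\{d\in D: v(d)>\gamma\}$ (both containing $0$). The associated graded ring is $\mathbf{gr}(D)=\bigoplus_{\gamma\in\Gamma_D}D^{\ge\gamma}/D^{>\gamma}$; for $a\in D^*$ write $\widetilde a=a+D^{>v(a)}$; multiplication is determined by $\widetilde a\,\widetilde b=\widetilde{ab}$. It is a graded division ring (every nonzero homogeneous element is invertible). $\mathbf{gr}(K)$ is the associated graded field of $K$ for the restricted valuation, viewed as a graded subring of $\mathbf{gr}(D)$, and $[\mathbf{gr}(D):\mathbf{gr}(K)]$ is the rank of $\mathbf{gr}(D)$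 as a (free) graded $\mathbf{gr}(K)$-module. $D$ is called tame over the Henselian field $K$ if $[\mathbf{gr}(D):\mathbf{gr}(K)]=[D:K]$ and $Z(\mathbf{gr}(D))=\mathbf{gr}(K)$. A maximal subgroup of a group $G$ is a proper subgroup not properly contained in any proper subgroup of $G$. A group is locally nilpotent if all its finitely generated subgroups are nilpotent. *)

(* Defs.v *)
From HB Require Import structures.
From mathcomp Require Import all_boot all_order all_algebra falgebra
  generic_quotient ring_quotient.
From mathcomp Require Import boolp classical_sets functions cardinality fsbigop.

Set Implicit Arguments.
Unset Strict Implicit.
Unset Printing Implicit Defensive.

Import Order.TTheory GRing.Theory Num.Theory.

Local Open Scope classical_set_scope.
Local Open Scope quotient_scope.
Local Open Scope ring_scope.

HB.mixin Record POrderedZmodule_isTotallyOrdered G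
    of Num.POrderedZmodule G := {
  oz_le_total : forall x y : G, (x <= y) || (y <= x);
  oz_leD2l_sub : forall x y z : G, x <= y -> z + x <= z + y
}.

#[short(type="orderedZmodType")]
HB.structure Definition OrderedZmodule :=
  { G of Num.POrderedZmodule G & POrderedZmodule_isTotallyOrdered G }.

Section OrderedZmoduleTheory.
Variable G : orderedZmodType.
Implicit Types x y z t : G.

Lemma oz_leNgt x y : (x <= y) = ~~ (y < x).
Proof. exact/comparable_leNgt/oz_le_total. Qed.

Lemma oz_ltNge x y : (x < y) = ~~ (y <= x).
Proof. exact/comparable_ltNge/oz_le_total. Qed.

Lemma oz_leD2l z x y : (z + x <= z + y) = (x <= y).
Proof.
apply/idP/idP => [h|]; last exact: oz_leD2l_sub.
by have := oz_leD2l_sub _ _ (- z) h; rewrite !addKr.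
Qed.

Lemma oz_leD2r z x y : (x + z <= y + z) = (x <= y).
Proof. by rewrite ![_ + z]addrC oz_leD2l. Qed.

Lemma oz_ltD2l z x y : (z + x < z + y) = (x < y).
Proof. by rewrite !oz_ltNge oz_leD2l. Qed.

Lemma oz_ltD2r z x y : (x + z < y + z) = (x < y).
Proof. by rewrite !oz_ltNge oz_leD2r. Qed.

Lemma oz_leD x y z t : x <= y -> z <= t -> x + z <= y + t.
Proof.
by move=> xy zt; apply: (@le_trans _ _ (y + z)); rewrite ?oz_leD2r ?oz_leD2l.
Qed.

Lemma oz_dbl_eq0 x : x + x = 0 -> x = 0.
Proof.
move=> h; apply/eqP; rewrite eq_le; apply/andP; split.
  rewrite oz_leNgt; apply/negP => x0.
  have : 0 < x + x by apply: (lt_trans x0); rewrite -{1}[x]addr0 oz_ltD2l.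
  by rewrite h ltxx.
rewrite oz_leNgt; apply/negP => x0.
have : x + x < 0 by apply: (lt_trans _ x0); rewrite -{3}[x]addr0 oz_ltD2l.
by rewrite h ltxx.
Qed.

End OrderedZmoduleTheory.

(* [option G] is G with an element [None] = oo adjoined. *)

Section Infinity.
Variable G : orderedZmodType.
Implicit Types a b : option G.

Definition vle a b :=
  match a, b with
  | _, None => true
  | None, Some _ => false
  | Some x, Some y => x <= y
  end.

Definition vlt a b := ~~ vle b a.

Definition vadd a b :=
  match a, b with
  | Some x, Some y => Some (x + y)
  | _, _ => None
  end.

Definition vmin a b := if vle a b then a else b.

Lemma vlexx a : vle a a. Proof. by case: a => /=. Qed.

Lemma vle_trans b a c : vle a b -> vle b c -> vle a c.
Proof. by case: a b c => [a|] [b|] [c|] //=; exact: le_trans. Qed.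

Lemma vle_total a b : vle a b || vle b a.
Proof. by case: a b => [a|] [b|] //=; exact: oz_le_total. Qed.

Lemma vlt_le a b : vlt a b -> vle a b.
Proof. by rewrite /vlt; have := vle_total a b; case: (vle b a); rewrite ?orbF. Qed.

Lemma vle_lt_trans b a c : vle a b -> vlt b c -> vlt a c.
Proof. by move=> ab; apply: contraNN => ca; exact: vle_trans ca ab. Qed.

Lemma vle_min c a b : vle c (vmin a b) = vle c a && vle c b.
Proof.
rewrite /vmin; case: ifPn => ab.
  by rewrite andb_idr // => /vle_trans; apply.
rewrite andbC andb_idr // => /vle_trans; apply; exact: vlt_le.
Qed.

Lemma vlt_min c a b : vlt c (vmin a b) = vlt c a && vlt c b.
Proof.
rewrite /vmin; case: ifPn => ab.
  by rewrite andb_idr // => ca; apply: contraNN ca => bc; exact: vle_trans ab bc.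
rewrite andbC andb_idr // => cb; apply: contraNN cb => ac.
exact: vle_trans (vlt_le ab) ac.
Qed.

Lemma vaddS_le (x y : G) a b :
  vle (Some x) a -> vle (Some y) b -> vle (Some (x + y)) (vadd a b).
Proof. by case: a b => [a|] [b|] //=; exact: oz_leD. Qed.

Lemma vaddS_ltl (x y : G) a b :
  vlt (Some x) a -> vle (Some y) b -> vlt (Some (x + y)) (vadd a b).
Proof.
case: a b => [a|] [b|] //=; rewrite /vlt /= -!oz_ltNge => xa yb.
by apply: (@lt_le_trans _ _ (a + y)); rewrite ?oz_ltD2r ?oz_leD2l.
Qed.

Lemma vaddS_ltr (x y : G) a b :
  vle (Some x) a -> vlt (Some y) b -> vlt (Some (x + y)) (vadd a b).
Proof.
case: a b => [a|] [b|] //=; rewrite /vlt /= -!oz_ltNge => xa yb.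
by apply: (@lt_le_trans _ _ (x + b)); rewrite ?oz_ltD2l ?oz_leD2r.
Qed.

End Infinity.

Record valuation (G : orderedZmodType) (R : nzRingType) := Valuation {
  val_fun :> R -> option G;
  val_inftyP : forall x, val_fun x = None <-> x = 0;
  val_geD : forall x y,
    vle (vmin (val_fun x) (val_fun y)) (val_fun (x + y));
  valM : forall x y, val_fun (x * y) = vadd (val_fun x) (val_fun y)
}.

Definition nontrivial_valuation (G : orderedZmodType) (R : nzRingType)
    (v : valuation G R) :=
  exists2 x, x <> 0 & v x <> Some 0.

Section ValuationTheory.
Variables (G : orderedZmodType) (R : nzRingType) (v : valuation G R).

Lemma val0 : v 0 = None. Proof. exact/val_inftyP. Qed.

Lemma val1 : v 1 = Some 0.
Proof.
have := valM v 1 1; rewrite mulr1.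
case e : (v 1) => [g|]; last by move/val_inftyP/eqP: e; rewrite oner_eq0.
by move=> [] /eqP; rewrite -subr_eq0 opprD addNKr oppr_eq0 => /eqP ->.
Qed.

Lemma valN x : v (- x) = v x.
Proof.
suff vN1 : v (-1) = Some 0.
  by rewrite -mulN1r valM vN1; case: (v x) => //= g; rewrite add0r.
have := valM v (-1) (-1); rewrite mulrNN mulr1 val1.
by case: (v (-1)) => //= g [] /esym /oz_dbl_eq0 ->.
Qed.

End ValuationTheory.

(* [w : L -> Delta + oo] extends [v : K -> Gamma + oo] along [iota : K -> L]
   when Gamma embeds in Delta, as an ordered group, compatibly with v and w. *)
Definition extends (G H : orderedZmodType) (K L : nzRingType)
    (iota : K -> L) (v : valuation G K) (w : valuation H L) :=
  exists j : {additive G -> H},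
    {mono j : x y / x <= y} /\ forall x, w (iota x) = omap j (v x).

(* The value group of a valuation is only defined up to isomorphism, so that
   valuations are identified when they order the elements in the same way. *)
Definition equivalent_valuations (G H : orderedZmodType) (R : nzRingType)
    (v : valuation G R) (w : valuation H R) :=
  forall x y, vle (v x) (v y) = vle (w x) (w y).

Definition henselian (G : orderedZmodType) (K : fieldType)
    (v : valuation G K) :=
  forall (L : fieldType) (iota : {rmorphism K -> L}),
    (forall x : L, algebraicOver iota x) ->
    (exists (H : orderedZmodType) (w : valuation H L), extends iota v w) /\
    (forall (H1 H2 : orderedZmodType)
            (w1 : valuation H1 L) (w2 : valuation H2 L),
       extends iota v w1 -> extends iota v w2 -> equivalent_valuations w1 w2).

Section GradedComponent.
Variables (G : orderedZmodType) (R : nzRingType) (v : valuation G R).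
Variable g : G.

Definition filt_ge : {pred R} := fun x => vle (Some g) (v x).

Fact filt_ge_zmod_closed : zmod_closed filt_ge.
Proof.
split=> [|x y]; rewrite !unfold_in ?val0 // => gx gy.
by apply: vle_trans (val_geD v _ _); rewrite vle_min valN gx.
Qed.
HB.instance Definition _ := GRing.isZmodClosed.Build R filt_ge
  filt_ge_zmod_closed.

Record filt := Filt { filt_val :> R; filtP : filt_val \in filt_ge }.
HB.instance Definition _ := [isSub for filt_val].
HB.instance Definition _ := [Choice of filt by <:].
HB.instance Definition _ := [SubChoice_isSubZmodule of filt by <:].

Definition filt_gt : {pred filt} := fun x => vlt (Some g) (v (val x)).

Fact filt_gt_zmod_closed : zmod_closed filt_gt.
Proof.
split=> [|x y]; rewrite !unfold_in ?raddf0 ?val0 // => gx gy.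
rewrite raddfB /=.
apply: contraNN (_ : ~~ vle (vmin (v (val x)) (v (- val y))) (Some g)) => [h|].
  exact: vle_trans (val_geD v _ _) h.
by rewrite -/(vlt _ _) vlt_min valN; apply/andP.
Qed.
HB.instance Definition _ := GRing.isZmodClosed.Build filt filt_gt
  filt_gt_zmod_closed.

Definition gr_comp := Quotient.quot filt_gt.
HB.instance Definition _ := GRing.Zmodule.on gr_comp.
HB.instance Definition _ := Quotient.on gr_comp.

(* The class of x when g <= v x, and 0 otherwise *)
Definition gr_cls (x : R) : gr_comp := \pi_gr_comp (insubd 0 x).

Definition gr_lift (c : gr_comp) : R := val (repr c).

Lemma gr_liftP c : vle (Some g) (v (gr_lift c)).
Proof. exact: (filtP (repr c)). Qed.

Lemma gr_liftK : cancel gr_lift gr_cls.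
Proof. by move=> c; rewrite /gr_cls /gr_lift valKd reprK. Qed.

Lemma gr_cls_eq x y : vle (Some g) (v x) -> vle (Some g) (v y) ->
  (gr_cls x == gr_cls y) = vlt (Some g) (v (x - y)).
Proof.
move=> gx gy; rewrite -[RHS]/(vlt _ _) /gr_cls -Quotient.idealrBE unfold_in.
by rewrite raddfB /= !insubdK.
Qed.

Lemma gr_clsD x y : vle (Some g) (v x) -> vle (Some g) (v y) ->
  gr_cls (x + y) = gr_cls x + gr_cls y.
Proof.
move=> gx gy; rewrite /gr_cls -(raddfD \pi_gr_comp).
congr (\pi _); apply: val_inj; rewrite raddfD /= !insubdK //.
exact: (rpredD (S := filt_ge)).
Qed.

Lemma gr_cls0 : gr_cls 0 = 0.
Proof.
have h0 : vle (Some g) (v 0) by rewrite val0.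
by apply: (addrI (gr_cls 0)); rewrite -gr_clsD // !addr0.
Qed.

Lemma gr_cls_eq0 x : vle (Some g) (v x) ->
  (gr_cls x == 0) = vlt (Some g) (v x).
Proof. by move=> gx; rewrite -gr_cls0 gr_cls_eq ?subr0 ?val0. Qed.

Lemma gr_comp_out : (forall x, v x <> Some g) -> forall c : gr_comp, c = 0.
Proof.
move=> vg c; rewrite -[c]gr_liftK; apply/eqP; rewrite gr_cls_eq0 ?gr_liftP //.
move: (gr_liftP c) (vg (gr_lift c)); case: (v _) => //= h le_gh ne_hg.
by rewrite /vlt /= -oz_ltNge lt_neqAle le_gh andbT; apply/eqP => e; rewrite e in ne_hg.
Qed.

End GradedComponent.

Section GradedRing.
Variables (G : orderedZmodType) (R : nzRingType) (v : valuation G R).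

(* The direct sum is taken over the whole of G instead of the value group of v:
   by [gr_comp_out] the components outside of the value group are zero. *)
Record gr := Gr {
  gr_fun :> forall g : G, gr_comp v g;
  gr_finite : finite_set [set g | gr_fun g != 0]
}.

HB.instance Definition _ := gen_eqMixin gr.
HB.instance Definition _ := gen_choiceMixin gr.

Lemma gr_ext (x y : gr) : (forall g, x g = y g) -> x = y.
Proof.
case: x y => [x fx] [y fy] /= e.
have {e} e : x = y by apply: functional_extensionality_dep.
by subst y; congr Gr; exact: Prop_irrelevance.
Qed.

Fact gr0_finite : finite_set [set g : G | (0 : gr_comp v g) != 0].
Proof. by apply: (sub_finite_set _ (finite_set0 G)) => g /=; rewrite eqxx. Qed.
Definition gr0 := @Gr (fun g => 0) gr0_finite.

Fact grN_finite (x : gr) : finite_set [set g | - x g != 0].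
Proof. by apply: sub_finite_set (gr_finite x) => g /=; rewrite oppr_eq0. Qed.
Definition grN x := Gr (grN_finite x).

Fact grD_finite (x y : gr) : finite_set [set g | x g + y g != 0].
Proof.
have fxy : finite_set ([set g | x g != 0] `|` [set g | y g != 0]).
  by rewrite finite_setU; split; exact: gr_finite.
apply: sub_finite_set fxy => g /=.
by apply: contra_neqP => /not_orP[/negP/negPn/eqP -> /negP/negPn/eqP ->]; rewrite addr0.
Qed.
Definition grD x y := Gr (grD_finite x y).

Fact grDA : associative grD.
Proof. by move=> x y z; apply: gr_ext => g; exact: addrA. Qed.
Fact grDC : commutative grD.
Proof. by move=> x y; apply: gr_ext => g; exact: addrC. Qed.
Fact gr0D : left_id gr0 grD.
Proof. by move=> x; apply: gr_ext => g; exact: add0r. Qed.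
Fact grND : left_inverse gr0 grN grD.
Proof. by move=> x; apply: gr_ext => g; exact: addNr. Qed.
HB.instance Definition _ := GRing.isZmodule.Build gr grDA grDC gr0D grND.

Lemma grDE (x y : gr) g : (x + y) g = x g + y g. Proof. by []. Qed.
Lemma gr0E g : (0 : gr) g = 0. Proof. by []. Qed.

(* Multiplication R^{>=h} / R^{>h} x R^{>=k} / R^{>k} -> R^{>=g} / R^{>g},
   meaningful for g = h + k *)
Definition gr_comp_mul g h k (a : gr_comp v h) (b : gr_comp v k) :=
  gr_cls v g (gr_lift a * gr_lift b).

Lemma gr_mul_ge h k x y : vle (Some h) (v x) -> vle (Some k) (v y) ->
  vle (Some (h + k)) (v (x * y)).
Proof. by rewrite valM; exact: vaddS_le. Qed.

Lemma gr_comp_mul_cls h k x y :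
  vle (Some h) (v x) -> vle (Some k) (v y) ->
  gr_comp_mul (h + k) (gr_cls v h x) (gr_cls v k y) = gr_cls v (h + k) (x * y).
Proof.
move=> hx ky; rewrite /gr_comp_mul.
set x' := gr_lift _; set y' := gr_lift _.
have hx' : vle (Some h) (v x') by exact: gr_liftP.
have ky' : vle (Some k) (v y') by exact: gr_liftP.
apply/eqP; rewrite gr_cls_eq ?gr_mul_ge //.
have dx : vlt (Some h) (v (x' - x)) by rewrite -gr_cls_eq // gr_liftK.
have dy : vlt (Some k) (v (y' - y)) by rewrite -gr_cls_eq // gr_liftK.
have -> : x' * y' - x * y = (x' - x) * y' + x * (y' - y).
  by rewrite mulrBl mulrBr addrA subrK.
set a := _ * y'; set b := x * _.
apply: contraNN (_ : ~~ vle (vmin (v a) (v b)) (Some (h + k))) => [e|].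
  exact: vle_trans (val_geD v _ _) e.
by rewrite -/(vlt _ _) vlt_min /a /b !valM vaddS_ltl ?vaddS_ltr.
Qed.

Lemma gr_comp_mulDl h k (a b : gr_comp v h) (c : gr_comp v k) :
  gr_comp_mul (h + k) (a + b) c =
  gr_comp_mul (h + k) a c + gr_comp_mul (h + k) b c.
Proof.
rewrite -[a]gr_liftK -[b]gr_liftK -[c]gr_liftK.
have := (gr_liftP a, gr_liftP b, gr_liftP c) => -[[pa pb] pc].
have pab := rpredD (S := filt_ge v h) pa pb.
rewrite -gr_clsD // !gr_comp_mul_cls //.
by rewrite mulrDl gr_clsD ?gr_mul_ge.
Qed.

Lemma gr_comp_mulDr h k (a : gr_comp v h) (b c : gr_comp v k) :
  gr_comp_mul (h + k) a (b + c) =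
  gr_comp_mul (h + k) a b + gr_comp_mul (h + k) a c.
Proof.
rewrite -[a]gr_liftK -[b]gr_liftK -[c]gr_liftK.
have := (gr_liftP a, gr_liftP b, gr_liftP c) => -[[pa pb] pc].
have pbc := rpredD (S := filt_ge v k) pb pc.
rewrite -gr_clsD // !gr_comp_mul_cls //.
by rewrite mulrDr gr_clsD ?gr_mul_ge.
Qed.

Lemma gr_comp_mul0l h k (c : gr_comp v k) :
  gr_comp_mul (h + k) (0 : gr_comp v h) c = 0.
Proof.
by apply: (addrI (gr_comp_mul (h + k) (0 : gr_comp v h) c)); rewrite -gr_comp_mulDl !addr0.
Qed.

Lemma gr_comp_mul0r h k (a : gr_comp v h) :
  gr_comp_mul (h + k) a (0 : gr_comp v k) = 0.
Proof.
by apply: (addrI (gr_comp_mul (h + k) a (0 : gr_comp v k))); rewrite -gr_comp_mulDr !addr0.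
Qed.

Lemma gr_comp_mulE g h k (a : gr_comp v h) (b : gr_comp v k) : h + k = g ->
  [/\ forall a', gr_comp_mul g (a + a') b =
        gr_comp_mul g a b + gr_comp_mul g a' b,
      forall b', gr_comp_mul g a (b + b') =
        gr_comp_mul g a b + gr_comp_mul g a b',
      gr_comp_mul g (0 : gr_comp v h) b = 0 &
      gr_comp_mul g a (0 : gr_comp v k) = 0].
Proof.
move=> <-; split=> [a'|b'||]; first exact: gr_comp_mulDl.
- exact: gr_comp_mulDr.
- exact: gr_comp_mul0l.
- exact: gr_comp_mul0r.
Qed.

Lemma oz_subKC (g h : G) : h + (g - h) = g.
Proof. by rewrite addrC subrK. Qed.

Lemma gr_mul_support (x y : gr) g :
  [set h | gr_comp_mul g (x h) (y (g - h)) != 0] `<=` [set h | x h != 0].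
Proof.
move=> h /=; apply: contra_neq => ->.
by have [_ _ -> _] := gr_comp_mulE (x h) (y (g - h)) (oz_subKC g h).
Qed.

(* Only finitely many h contribute, since x has finite support. *)
Definition gr_mul_fun (x y : gr) g : gr_comp v g :=
  \sum_(h \in [set: G]) gr_comp_mul g (x h) (y (g - h)).

Fact gr_mul_finite (x y : gr) : finite_set [set g | gr_mul_fun x y g != 0].
Proof.
have fin := finite_image2 (fun h k => h + k) (gr_finite x) (gr_finite y).
apply: sub_finite_set fin => g /= nz; apply: contrapT => /= nex.
move/eqP: nz; apply; apply: fsbig1 => h _.
have [_ _ m0l m0r] := gr_comp_mulE (x h) (y (g - h)) (oz_subKC g h).
have [xh0|xh] := eqVneq (x h) 0; first by rewrite xh0.
have [yh0|yh] := eqVneq (y (g - h)) 0; first by rewrite yh0.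
by case: nex; exists h => //; exists (g - h) => //; rewrite oz_subKC.
Qed.

Definition gr_mul x y := Gr (gr_mul_finite x y).

Lemma gr_mul_funE (x y : gr) g (P : set G) : [set h | x h != 0] `<=` P ->
  gr_mul x y g = \sum_(h \in P) gr_comp_mul g (x h) (y (g - h)).
Proof.
move=> xP; rewrite [LHS]/(gr_mul_fun x y g) /gr_mul_fun; symmetry.
apply: fsbig_widen => // h [_ nPh] /=; apply: contrapT => nz; apply: nPh.
by apply/xP/(@gr_mul_support x y g) => /=; apply/eqP.
Qed.

Fact gr_mulDl : left_distributive gr_mul +%R.
Proof.
move=> x y z; apply: gr_ext => g; rewrite grDE.
pose P := [set h | x h != 0] `|` [set h | y h != 0].
have finP : finite_set P by rewrite finite_setU; split; exact: gr_finite.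
rewrite (@gr_mul_funE x _ _ P) 1?(@gr_mul_funE y _ _ P); last 2 first.
- by move=> h nz; right.
- by move=> h nz; left.
rewrite (@gr_mul_funE _ _ _ P) => [|h /= nz].
  rewrite -fsbig_split //; apply: eq_fsbigr => h _.
  by have [-> _ _ _] := gr_comp_mulE (x h) (z (g - h)) (oz_subKC g h).
apply: contrapT => /not_orP[] /= /negP/negPn/eqP x0 /negP/negPn/eqP y0.
by rewrite x0 y0 addr0 eqxx in nz.
Qed.

Fact gr_mulDr : right_distributive gr_mul +%R.
Proof.
move=> x y z; apply: gr_ext => g; rewrite grDE.
have finP := gr_finite x.
rewrite !(@gr_mul_funE _ _ _ [set h | x h != 0]) //.
rewrite -fsbig_split //; apply: eq_fsbigr => h _.
by have [_ -> _ _] := gr_comp_mulE (x h) (y (g - h)) (oz_subKC g h).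
Qed.

(* For g <= v a, the class of a in degree g; when v a = g this is the element
   written a with a tilde, and [gr_homM] is the usual product formula. *)
Definition gr_hom_fun (g : G) (a : R) h : gr_comp v h :=
  if h == g then gr_cls v h a else 0.

Fact gr_hom_finite g a : finite_set [set h | gr_hom_fun g a h != 0].
Proof.
apply: (sub_finite_set _ (finite_set1 g)) => h /=; rewrite /gr_hom_fun.
by case: (eqVneq h g) => //; rewrite eqxx.
Qed.

Definition gr_hom g a := Gr (gr_hom_finite g a).

Lemma gr_homE g a h : gr_hom g a h = if h == g then gr_cls v h a else 0.
Proof. by []. Qed.

Lemma gr_mul_hom g h a b : vle (Some g) (v a) -> vle (Some h) (v b) ->
  gr_mul (gr_hom g a) (gr_hom h b) = gr_hom (g + h) (a * b).
Proof.
move=> ga hb; apply: gr_ext => d; rewrite (@gr_mul_funE _ _ _ [set g]); last first.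
  by move=> i /=; rewrite /gr_hom_fun; case: (eqVneq i g) => // _; rewrite eqxx.
rewrite fsbig_set1 !gr_homE eqxx /gr_hom_fun.
have [_ _ _ m0] := gr_comp_mulE (gr_cls v g a) (gr_hom h b (d - g)) (oz_subKC d g).
case: (eqVneq d (g + h)) => [->|ne].
  have -> : g + h - g = h by rewrite addrC addKr.
  by rewrite !eqxx gr_comp_mul_cls.
case: eqP => [e|_]; last exact: m0.
by rewrite -e oz_subKC eqxx in ne.
Qed.

Lemma gr_ind (P : gr -> Prop) : P 0 ->
  (forall g a y, vle (Some g) (v a) -> P y -> P (gr_hom g a + y)) ->
  forall x, P x.
Proof.
move=> P0 PD x; have /finite_seqP[s sE] := gr_finite x.
have : forall g, x g != 0 -> g \in s.
  move=> g nz; have : [set h | x h != 0] g by [].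
  by rewrite sE.
elim: s x {sE} => [|g s IHs] x sx.
  rewrite (_ : x = 0) //; apply: gr_ext => g; apply/eqP/negPn/negP => nz.
  by have := sx _ nz.
pose x0 := gr_hom g (gr_lift (x g)).
rewrite -[x](subrK x0) addrC; apply: PD; first exact: gr_liftP.
apply: IHs => h; rewrite -[(x - x0) h]/(x h - x0 h) gr_homE.
case: (eqVneq h g) => [->|/negPf ne]; first by rewrite gr_liftK subrr eqxx.
by rewrite subr0 => /sx; rewrite inE ne.
Qed.

Lemma gr_mul0x x : gr_mul 0 x = 0.
Proof. by apply: (addrI (gr_mul 0 x)); rewrite -gr_mulDl !addr0. Qed.

Lemma gr_mulx0 x : gr_mul x 0 = 0.
Proof. by apply: (addrI (gr_mul x 0)); rewrite -gr_mulDr !addr0. Qed.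

Fact gr_mulA : associative gr_mul.
Proof.
move=> x y z; elim/gr_ind: x => [|g a x ga IHx]; first by rewrite !gr_mul0x.
rewrite !gr_mulDl IHx; congr (_ + _); clear IHx.
elim/gr_ind: y => [|h b y hb IHy]; first by rewrite gr_mul0x !gr_mulx0 gr_mul0x.
rewrite gr_mulDl !gr_mulDr gr_mulDl IHy; congr (_ + _); clear IHy.
elim/gr_ind: z => [|k c z kc IHz]; first by rewrite !gr_mulx0.
rewrite !gr_mulDr IHz; congr (_ + _); clear IHz.
by rewrite !gr_mul_hom ?gr_mul_ge // addrA mulrA.
Qed.

Definition gr1 := gr_hom 0 1.

Fact gr_mul1x : left_id gr1 gr_mul.
Proof.
elim/gr_ind => [|g a x ga IHx]; first by rewrite gr_mulx0.
by rewrite gr_mulDr IHx gr_mul_hom ?val1 /= ?add0r ?mul1r.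
Qed.

Fact gr_mulx1 : right_id gr1 gr_mul.
Proof.
elim/gr_ind => [|g a x ga IHx]; first by rewrite gr_mul0x.
by rewrite gr_mulDl IHx gr_mul_hom ?val1 /= ?addr0 ?mulr1.
Qed.

Fact gr1_neq0 : gr1 != 0.
Proof.
apply/eqP => /(congr1 (fun x : gr => x 0)) /eqP; rewrite gr_homE eqxx gr0E.
by rewrite gr_cls_eq0 val1 /vlt /= lexx.
Qed.

HB.instance Definition _ := GRing.Zmodule_isNzRing.Build gr
  gr_mulA gr_mul1x gr_mulx1 gr_mulDl gr_mulDr gr1_neq0.

Lemma gr_homM g h a b : vle (Some g) (v a) -> vle (Some h) (v b) ->
  gr_hom g a * gr_hom h b = gr_hom (g + h) (a * b).
Proof. exact: gr_mul_hom. Qed.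

Lemma gr_homD g a b : vle (Some g) (v a) -> vle (Some g) (v b) ->
  gr_hom g (a + b) = gr_hom g a + gr_hom g b.
Proof.
move=> ga gb; apply: gr_ext => h; rewrite grDE !gr_homE.
by case: eqVneq => [->|_]; [exact: gr_clsD | rewrite addr0].
Qed.

Definition homogeneous (x : gr) := exists g, forall h, h != g -> x h = 0.

End GradedRing.

Section Restriction.
Variables (G : orderedZmodType) (K : fieldType) (R : nzRingType).
Variables (iota : {rmorphism K -> R}) (w : valuation G R).

Fact val_restr_inftyP x : w (iota x) = None <-> x = 0.
Proof.
split=> [/val_inftyP /eqP|->]; first by rewrite fmorph_eq0 => /eqP.
by rewrite rmorph0 val0.
Qed.

Fact val_restr_geD x y :
  vle (vmin (w (iota x)) (w (iota y))) (w (iota (x + y))).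
Proof. by rewrite rmorphD; exact: val_geD. Qed.

Fact val_restrM x y : w (iota (x * y)) = vadd (w (iota x)) (w (iota y)).
Proof. by rewrite rmorphM valM. Qed.

Definition val_restr : valuation G K :=
  Valuation val_restr_inftyP val_restr_geD val_restrM.

Definition gr_incl_fun (x : gr val_restr) g : gr_comp w g :=
  gr_cls w g (iota (gr_lift (x g))).

Lemma gr_incl_cls g a : vle (Some g) (w (iota a)) ->
  gr_cls w g (iota (gr_lift (gr_cls val_restr g a))) = gr_cls w g (iota a).
Proof.
move=> ga; have gb := gr_liftP (gr_cls val_restr g a).
apply/eqP; rewrite gr_cls_eq // -rmorphB.
by rewrite -[X in vlt _ X]/(val_restr _) -gr_cls_eq // gr_liftK.
Qed.

Lemma gr_incl_comp0 g :
  gr_cls w g (iota (gr_lift (0 : gr_comp val_restr g))) = 0.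
Proof.
by rewrite -(gr_cls0 val_restr) gr_incl_cls rmorph0 ?gr_cls0 // val0.
Qed.

Fact gr_incl_finite x : finite_set [set g | gr_incl_fun x g != 0].
Proof.
apply: (sub_finite_set _ (gr_finite x)) => g /=; apply: contra_neq => xg.
by rewrite /gr_incl_fun xg gr_incl_comp0.
Qed.

(* The canonical map gr(K) -> gr(R), sending the class of a in degree g to the
   class of iota a ([gr_incl_hom]); it identifies gr(K) with a graded subring
   of gr(R). *)
Definition gr_incl (x : gr val_restr) : gr w := Gr (gr_incl_finite x).

Fact gr_inclD x y : gr_incl (x + y) = gr_incl x + gr_incl y.
Proof.
apply: gr_ext => g; rewrite grDE /= /gr_incl_fun.
have xg := gr_liftP (x g); have yg := gr_liftP (y g).
have xyg := rpredD (S := filt_ge val_restr g) xg yg.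
rewrite -gr_clsD // -rmorphD -[RHS]gr_incl_cls //.
by rewrite gr_clsD // !gr_liftK.
Qed.

Fact gr_incl_is_zmod_morphism : zmod_morphism gr_incl.
Proof.
by move=> x y; apply: (addIr (gr_incl y)); rewrite -gr_inclD !subrK.
Qed.

HB.instance Definition _ := GRing.isZmodMorphism.Build (gr val_restr) (gr w)
  gr_incl gr_incl_is_zmod_morphism.

Lemma gr_incl_hom g a : vle (Some g) (w (iota a)) ->
  gr_incl (gr_hom val_restr g a) = gr_hom w g (iota a).
Proof.
move=> ga; apply: gr_ext => h; rewrite /= /gr_incl_fun gr_homE /gr_hom_fun.
by case: eqVneq => [->|_]; [exact: gr_incl_cls | exact: gr_incl_comp0].
Qed.

Fact gr_incl_is_monoid_morphism : monoid_morphism gr_incl.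
Proof.
split=> [|x y].
  by rewrite -[1]/(gr_hom val_restr 0 1) gr_incl_hom rmorph1 ?val1 /=.
elim/gr_ind: x => [|g a x ga IHx]; first by rewrite mul0r raddf0 mul0r.
rewrite mulrDl !raddfD /= mulrDl IHx; congr (_ + _); clear IHx.
elim/gr_ind: y => [|h b y hb IHy]; first by rewrite mulr0 raddf0 mulr0.
rewrite mulrDr !raddfD /= mulrDr IHy; congr (_ + _); clear IHy.
by rewrite gr_homM ?gr_incl_hom ?gr_homM ?rmorphM // gr_mul_ge.
Qed.

HB.instance Definition _ := GRing.isMonoidMorphism.Build (gr val_restr) (gr w)
  gr_incl gr_incl_is_monoid_morphism.

Lemma gr_incl_inj : injective gr_incl.
Proof.
apply: raddf_inj => x /(congr1 (fun z : gr w => z _)) x0; apply: gr_ext => g.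
have := x0 g => /eqP; rewrite /= /gr_incl_fun gr_cls_eq0 => [lt|].
  by apply/eqP; rewrite -[x g]gr_liftK gr_cls_eq0 ?gr_liftP.
exact: (gr_liftP (v := val_restr)).
Qed.

End Restriction.

Arguments val_restr {G K R} iota w.
Arguments gr_incl {G K R} iota w x.

Section Tame.
Variables (G : orderedZmodType) (K : fieldType) (D : falgType K).
Variable w : valuation G D.

Local Notation incl := (gr_incl (in_alg D) w).

(* gr(D) is a free graded gr(K)-module of rank n: it has a basis of n
   homogeneous elements. *)
Definition gr_rank (n : nat) :=
  exists e : 'I_n -> gr w,
    (forall i, homogeneous (e i)) /\
    (forall x : gr w, exists! c : {ffun 'I_n -> gr (val_restr (in_alg D) w)},
       x = \sum_(i < n) incl (c i) * e i).

Definition gr_center_eq :=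
  forall z : gr w, (forall x, z * x = x * z) <-> exists c, z = incl c.

Definition tame := gr_rank (\dim {:D}) /\ gr_center_eq.

End Tame.

Section GroupDefs.
Variable G : groupType.
Implicit Types A B H M : set G.
Local Open Scope group_scope.

Definition is_subgroup H :=
  [/\ H 1, forall x y, H x -> H y -> H (x * y) & forall x, H x -> H x^-1].

Definition generated A : set G := smallest is_subgroup A.

Definition commutator_subgroup A B : set G :=
  generated [set z | exists x y, [/\ A x, B y & z = [~ x, y]]].

Fixpoint lower_central H n : set G :=
  if n is m.+1 then commutator_subgroup (lower_central H m) H else H.

Definition nilpotent_group H := exists n, lower_central H n = [set 1].

Definition locally_nilpotent H :=
  forall A, finite_set A -> A `<=` H -> nilpotent_group (generated A).

Definition maximal_subgroup M :=
  [/\ is_subgroup M, M <> [set: G] &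
      forall H, is_subgroup H -> M `<=` H -> H <> [set: G] -> H = M].

End GroupDefs.

Section UnitGroup.
Variable R : unitRingType.

(* D^* when applied to a division algebra D *)
Record unit_group := UnitGroup { ug_val :> R; ugP : ug_val \is a GRing.unit }.
HB.instance Definition _ := [isSub for ug_val].
HB.instance Definition _ := [Choice of unit_group by <:].
Implicit Types x y z : unit_group.

Fact ug_mulP x y : val x * val y \is a GRing.unit.
Proof. by rewrite unitrMl ?ugP. Qed.
Fact ug_invP x : (val x)^-1 \is a GRing.unit.
Proof. by rewrite unitrV ugP. Qed.

Definition ug_one := UnitGroup (unitr1 R).
Definition ug_mul x y := UnitGroup (ug_mulP x y).
Definition ug_inv x := UnitGroup (ug_invP x).

Fact ug_mulA : associative ug_mul.
Proof. by move=> x y z; apply: val_inj; exact: mulrA. Qed.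
Fact ug_mul1 : left_id ug_one ug_mul.
Proof. by move=> x; apply: val_inj; exact: mul1r. Qed.
Fact ug_mulx1 : right_id ug_one ug_mul.
Proof. by move=> x; apply: val_inj; exact: mulr1. Qed.
Fact ug_mulV : left_inverse ug_one ug_inv ug_mul.
Proof. by move=> x; apply: val_inj; apply: mulVr (ugP x). Qed.
Fact ug_mulxV : right_inverse ug_one ug_inv ug_mul.
Proof. by move=> x; apply: val_inj; apply: mulrV (ugP x). Qed.

HB.instance Definition _ := isGroup.Build unit_group
  ug_mulA ug_mul1 ug_mulx1 ug_mulV ug_mulxV.

Lemma ug_val1 : val (1%g : unit_group) = 1. Proof. by []. Qed.
Lemma ug_valM x y : val (x * y)%g = val x * val y. Proof. by []. Qed.
Lemma ug_valV x : val (x^-1)%g = (val x)^-1. Proof. by []. Qed.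

End UnitGroup.

Definition division_algebra (K : fieldType) (D : falgType K) :=
  forall x : D, x != 0 -> x \is a GRing.unit.

Definition central_algebra (K : fieldType) (D : falgType K) :=
  ('Z({:D}) = 1)%VS.

(* Main.v *)
Require Import Defs.
From HB Require Import structures.
From mathcomp Require Import all_boot all_order all_algebra falgebra.
From mathcomp Require Import boolp classical_sets cardinality.

(* Let M be a locally nilpotent maximal subgroup of D^*.

   Suppose that M is abelian and let U be the normal subgroup of 1-units of D,
   those u with w (u - 1) > 0. Rescaling by K shows that U is not abelian, so
   U M = D^* by maximality. Then every nonzero homogeneous element of gr(D) is
   the class of an element of M, so gr(D) is commutative, hence equal to its
   center gr(K), and [D : K] = [gr(D) : gr(K)] = 1.

   Suppose that M is not abelian. Since the elements of M that centralize a
   finite part of M modulo C(M) are K-linearly independent as soon as they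
   define distinct characters, there is a noncentral a in M with [a, M]
   central in M. By maximality and Hua's trick C(M) = K and L^* is contained
   in M, where L is the bicentralizer of a: otherwise D^* would send a to
   scalar multiples of itself by conjugation. Now a^m = k a for some m in M and
   some root of unity k <> 1 of K, of order r say. For t in K, the element
   y = 1 + t a is in L^*, hence in M. Local nilpotency makes some iterated
   commutator [y, m, ..., m] trivial, so that y^(r^n) commutes with m, i.e.
   [y, m]^(r^n) = 1. But when the value of t is large, [y, m] <> 1 is too close
   to 1 to be a root of unity of order dividing r^n. *)

Set Implicit Arguments.
Unset Strict Implicit.
Unset Printing Implicit Defensive.

Import Order.TTheory GRing.Theory.

Local Open Scope classical_set_scope.
Local Open Scope ring_scope.

(** Used with dimensions of spans and lengths of lists, both bounded by the dimension of [D]. *)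
Lemma exists_maximum (T : Type) (P : T -> Prop) (f : T -> nat) (N : nat) :
  (exists x, P x) -> (forall x, P x -> (f x <= N)%N) ->
  exists2 x, P x & forall y, P y -> (f y <= f x)%N.
Proof.
move=> [x0 Px0] ub.
pose Q n := `[< exists2 x, P x & f x = n >].
have exQ : exists n, Q n by exists (f x0); apply/asboolP; exists x0.
have ubQ n : Q n -> (n <= N)%N by move=> /asboolP[x Px <-]; exact: ub.
have [n /asboolP[x Px fx] max] := ex_maxnP exQ ubQ.
exists x => // y Py; rewrite fx; apply: max; apply/asboolP; by exists y.
Qed.

(** * Subgroups, commutators and nilpotency *)

Section GroupLemmas.
Variable G : groupType.
Implicit Types A B H : set G.
Local Open Scope group_scope.

Definition centralizer H : set G := [set x | forall h, H h -> commute x h].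

Lemma generated_subgroup A : is_subgroup (generated A).
Proof.
split=> [H [[]] //|x y Ax Ay H HA|x Ax H HA].
  by have [[_ HM _] _] := HA; apply: HM; [exact: Ax|exact: Ay].
by have [[_ _ HV] _] := HA; apply: HV; exact: Ax.
Qed.

Lemma sub_generated A : A `<=` generated A.
Proof. by move=> x Ax H [_]; apply. Qed.

Lemma generated_sub A H : is_subgroup H -> A `<=` H -> generated A `<=` H.
Proof. by move=> sH AH x; apply. Qed.

Lemma subgroup_conj H x y : is_subgroup H -> H x -> H y -> H (x ^ y).
Proof. by case=> _ HM HV Hx Hy; apply: (HM); [exact: HV|exact: HM]. Qed.

Lemma subgroup_comm H x y : is_subgroup H -> H x -> H y -> H [~ x, y].
Proof.
by move=> sH Hx Hy; have [_ HM HV] := sH; apply: HM; [exact: HV|exact: subgroup_conj].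
Qed.

Lemma lower_central_sub H n : is_subgroup H -> lower_central H n `<=` H.
Proof.
move=> sH; elim: n => [//|n IHn] /=.
apply: generated_sub => // _ [x [y [/IHn Hx Hy ->]]]; exact: subgroup_comm.
Qed.

Lemma iter_commg_lower_central H x m n : H x -> H m ->
  lower_central H n (iter n (fun z => [~ z, m]) x).
Proof.
move=> Hx Hm; elim: n => [//|n IHn]; rewrite iterS.
by apply: sub_generated; exists (iter n (fun z => [~ z, m]) x), m.
Qed.

(** An element of the last noncentral term of the lower central series works: its commutators with
    [H] lie in the next term, which is central. *)
Lemma nilpotent_second_center H : is_subgroup H -> nilpotent_group H ->
  ~ (H `<=` centralizer H) ->
  exists z, [/\ H z, ~ centralizer H z &
    forall h, H h -> centralizer H [~ z, h]].
Proof.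
move=> sH [n Hn] nab.
have : lower_central H n `<=` centralizer H.
  by rewrite Hn => _ -> h _; apply/commute_sym/commute1.
elim: n {Hn} => [//|n IHn] cHn.
have [/IHn //|nc] := pselect (lower_central H n `<=` centralizer H).
have /existsNP[z /not_implyP[Hz ncz]] := nc.
exists z; split=> //; first exact: lower_central_sub Hz.
by move=> h Hh; apply: cHn; apply: sub_generated; exists z, h.
Qed.

Lemma mulg_subgroup A B : is_subgroup A -> is_subgroup B ->
  (forall a b, A a -> B b -> A (a ^ b)) ->
  is_subgroup [set x | exists a b, [/\ A a, B b & x = a * b]].
Proof.
move=> [A1 AM AV] [B1 BM BV] nAB.
split=> [|_ _ [a [b [Aa Bb ->]]] [c [d [Ac Bd ->]]]|_ [a [b [Aa Bb ->]]]].
- by exists 1, 1; rewrite mulg1.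
- exists (a * c ^ b^-1), (b * d); split; [|exact: BM|].
    by apply: AM => //; apply: nAB => //; exact: BV.
  by rewrite conjgE invgK !mulgA mulgVK.
- exists (a^-1 ^ b), b^-1; split; [|exact: BV|].
    by apply: nAB => //; exact: AV.
  by rewrite conjgE invgM !mulgA mulgK.
Qed.

(** [M] normalizes [A], so the products [a * m] form a subgroup containing [M]; by maximality it is
    [M] or the whole group. *)
Lemma maximal_subgroup_mul A M : maximal_subgroup M -> is_subgroup A ->
  (forall a m, A a -> M m -> A (a ^ m)) ->
  A `<=` M \/ forall x, exists a m, [/\ A a, M m & x = a * m].
Proof.
move=> [sM _ maxM] sA nAM.
pose AM := [set x | exists a m, [/\ A a, M m & x = a * m]].
have sAM : is_subgroup AM by exact: mulg_subgroup.
have [A1 _ _] := sA; have [M1 _ _] := sM.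
have [AMT|AMT] := pselect (AM = [set: G]).
  by right=> x; have : [set: G] x by []; rewrite -AMT.
left; rewrite -(maxM AM sAM _ AMT) => [|m Mm]; last by exists 1, m; rewrite mul1g.
by move=> a Aa; exists a, 1; rewrite mulg1.
Qed.

(* With sigma the conjugation by m on A, the hypotheses say sigma ^ r = 1 and
   (sigma - 1) ^ k = 0 at x. Inductively e = [~ x, m] ^+ (r ^ k) is fixed by
   sigma, and sigma ^ r = 1 then forces e ^+ r = 1. *)
Lemma iter_commg_expn_fixed A m r k x : is_subgroup A ->
  (forall a b, A a -> A b -> commute a b) ->
  (forall a, A a -> A (a ^ m)) -> (forall a, A a -> commute a (m ^+ r)) ->
  A x -> iter k (fun z => [~ z, m]) x = 1 ->
  (x ^+ (r ^ k)) ^ m = x ^+ (r ^ k).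
Proof.
move=> sA cA nA cAr; have [A1 AM AV] := sA.
have AX a n : A a -> A (a ^+ n).
  by move=> Aa; elim: n => [|n IHn]; rewrite ?expgS //; exact: AM.
elim: k x => [|k IHk] x Ax; first by move=> /= ->; rewrite expg1 conj1g.
rewrite iterSr => /IHk fix_e.
have Ay : A [~ x, m] by apply: AM; [exact: AV|exact: nA].
set y := [~ x, m] in fix_e Ay; set q := (r ^ k)%N in fix_e *.
have {}fix_e := fix_e Ay; set e := y ^+ q in fix_e.
pose z := x ^+ q; have Ae : A e by exact: AX.
have Az : A z by exact: AX.
have zm : z ^ m = z * e.
  by rewrite conjXg -[x ^ m](mulVKg x) -commgEl expgMn //; exact: cA.
have zmi i : z ^ (m ^+ i) = z * e ^+ i.
  elim: i => [|i IHi]; first by rewrite conjg1 mulg1.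
  by rewrite expgSr conjgM IHi conjMg zm [X in _ * X]conjXg fix_e -mulgA -expgS.
have er : e ^+ r = 1.
  apply: (mulgI z); rewrite -zmi mulg1 conjgE.
  by rewrite [z * _](cAr _ Az) mulKg.
rewrite expnSr expgnA -/z conjXg zm expgMn; last exact: cA.
by rewrite er mulg1.
Qed.

End GroupLemmas.

(** * Division algebras *)

Section DivisionAlgebra.
Variables (K : fieldType) (D : falgType K).
Hypothesis D_division : division_algebra D.
Local Notation Du := (unit_group D).
Implicit Types (u m : Du) (M S : set Du).

Definition division_unit (x : D) (x0 : x != 0) : Du := UnitGroup (D_division x0).

Lemma ug_neq0 u : val u != 0.
Proof. by apply: contraTneq (ugP u) => ->; rewrite unitr0. Qed.

Lemma ug_valX u n : val (u ^+ n)%g = val u ^+ n.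
Proof. by elim: n => [//|n IHn]; rewrite expgS ug_valM IHn exprS. Qed.

Lemma div_mulf_eq0 (x y : D) : x * y = 0 -> x = 0 \/ y = 0.
Proof.
move=> xy; have [|x0] := eqVneq x 0; first by left.
by right; apply: (mulrI (D_division x0)); rewrite mulr0.
Qed.

Lemma centralizerP M u :
  centralizer M u <-> forall m, M m -> val u * val m = val m * val u.
Proof.
by split=> cu m /cu; [move/(congr1 val)|move=> e; apply: val_inj].
Qed.

(** For [A] the centralizer of a set, these are the units of the bicentralizer of that set. *)
Definition unit_centralizer (A : set D) : set Du :=
  [set u | forall x, A x -> val u * x = x * val u].

Lemma unit_centralizer_subgroup A : is_subgroup (unit_centralizer A).
Proof.
split=> [x _|u m cu cm x Ax|u cu x Ax].
- by rewrite mul1r mulr1.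
- by rewrite ug_valM -mulrA cm // mulrA cu // mulrA.
- rewrite ug_valV; apply: (mulrI (ugP u)); rewrite mulrA mulrV ?ugP // mul1r.
  by rewrite mulrA cu // -mulrA mulrV ?ugP // mulr1.
Qed.

(* Hua's trick: compare the conjugates of a by m and by 1 + m. *)
Lemma commute_of_semicommute1D (a m c d : D) : a != 0 ->
  a * m = c * (m * a) -> a * (1 + m) = d * ((1 + m) * a) ->
  c * a = a * c -> d * a = a * d -> a * m = m * a.
Proof.
move=> a0 am a1m ca da; have Ua := D_division a0.
(* If [c = d], this identity forces [d = 1]; otherwise it makes [m] a quotient of elements commuting
   with [a]. *)
have e : (c - d) * m = d - 1.
  apply: (mulIr Ua); rewrite !mulrBl mul1r -!mulrA -am.
  move: a1m; rewrite mulrDr mulr1 mulrDl mul1r mulrDr => a1m.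
  have -> : a * m = d * a + d * (m * a) - a by rewrite -a1m addrC addKr.
  by rewrite addrAC addrK.
have [cd|cd] := eqVneq (c - d) 0.
  move/eqP: e; rewrite cd mul0r eq_sym subr_eq0 => /eqP d1.
  by move/eqP: cd; rewrite am subr_eq0 d1 => /eqP ->; rewrite mul1r.
have Ucd := D_division cd; apply: (mulrI Ucd).
have acd : a * (c - d) = (c - d) * a by rewrite mulrBr mulrBl ca da.
by rewrite !mulrA e -acd -mulrA e mulrBr mulrBl mulr1 mul1r da.
Qed.

(** Artin's independence of characters: conjugation by [s] in [S] fixes the coefficients and
    multiplies [x] by the character value [[~ x, s]], so the terms of a relation can be eliminated
    one at a time. *)
Lemma separated_free (F : set D) S (l : seq Du) (f : Du -> D) :
  (forall x y, F x -> F y -> F (x - y)) ->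
  (forall x y, F x -> F y -> F (x * y)) ->
  (forall x y, F x -> F y -> x * y = y * x) ->
  (forall x s, F x -> S s -> x * val s = val s * x) ->
  uniq l -> (forall x s, x \in l -> S s -> F (val [~ x, s]%g)) ->
  {in l &, forall x y, x != y -> exists2 s, S s & [~ x, s]%g <> [~ y, s]%g} ->
  (forall x, x \in l -> F (f x)) -> \sum_(x <- l) val x * f x = 0 ->
  forall x, x \in l -> f x = 0.
Proof.
move=> FB FM FC FS; elim: l f => [//|b l IHl] f.
rewrite cons_uniq => /andP[bl ul] Fl sep Ff.
rewrite big_cons => sum0.
have l_sub x : x \in l -> x \in b :: l by rewrite inE orbC => ->.
have bb : b \in b :: l by rewrite inE eqxx.
have f0 x : x \in l -> f x = 0.
  move=> xl; have xb : x != b by apply: contraNneq bl => <-.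
  have [s Ss xs] := sep _ _ (l_sub _ xl) bb xb.
  pose chi y := val [~ y, s]%g.
  have chiE y : val y * val s = val s * (val y * chi y).
    by rewrite /chi -!ug_valM {1}commgC -mulgA.
  (* The coefficients of the shorter relation obtained by conjugating the given one by [s] and
     subtracting its multiple by [chi b]; the term of [b] cancels. *)
  pose g y := f y * (chi y - chi b).
  have Fchi y : y \in b :: l -> F (chi y) by move=> yl; exact: Fl.
  have : g x = 0.
    apply: (IHl g) xl => //.
    - by move=> y t /l_sub; exact: Fl.
    - by move=> y z /l_sub yl /l_sub zl; exact: sep.
    - move=> y /l_sub yl; apply: FM; first exact: Ff.
      by apply: FB; exact: Fchi.
    have e1 : val b * f b * chi b + \sum_(y <- l) val y * f y * chi b = 0.
      by rewrite -mulr_suml -mulrDl sum0 mul0r.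
    have e2 : val b * f b * chi b + \sum_(y <- l) val y * f y * chi y = 0.
      apply: (mulrI (ugP s)); rewrite mulr0 mulrDr mulr_sumr.
      have e0 : (val b * f b + \sum_(y <- l) val y * f y) * val s = 0.
        by rewrite sum0 mul0r.
      apply: etrans e0; rewrite mulrDl mulr_suml.
      have E y : y \in b :: l ->
          val s * (val y * f y * chi y) = val y * f y * val s.
        move=> yl; rewrite -mulrA (FC (f y)); [|exact: Ff|exact: Fchi].
        by rewrite -[RHS]mulrA (FS (f y)) ?[RHS]mulrA ?chiE -?mulrA //; exact: Ff.
      rewrite E //; congr (_ + _); rewrite [LHS]big_seq [RHS]big_seq; apply: eq_bigr => y yl.
      by rewrite E // l_sub.
    transitivity (\sum_(y <- l) val y * f y * chi y -
        \sum_(y <- l) val y * f y * chi b).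
      by rewrite -sumrB; apply: eq_bigr => y _; rewrite /g mulrA mulrBr.
    apply/eqP; rewrite subr_eq0; apply/eqP.
    by apply: (addrI (val b * f b * chi b)); rewrite e1 e2.
  move/div_mulf_eq0 => [//|/eqP]; rewrite subr_eq0 => /eqP e.
  by case: xs; apply: val_inj.
move=> x; rewrite inE => /predU1P[->|]; last exact: f0.
move: sum0; rewrite big_seq big1 ?addr0 => [|y yl]; last by rewrite f0 ?mulr0.
by case/div_mulf_eq0 => // /eqP; rewrite (negPf (ug_neq0 b)).
Qed.

(** As [F] contains the scalars, [separated_free] makes the elements of [l] linearly independent
    over [K]. *)
Lemma size_separated (F : set D) S (l : seq Du) :
  (forall x y, F x -> F y -> F (x - y)) ->
  (forall x y, F x -> F y -> F (x * y)) ->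
  (forall x y, F x -> F y -> x * y = y * x) ->
  (forall x s, F x -> S s -> x * val s = val s * x) ->
  (forall k : K, F k%:A) ->
  uniq l -> (forall x s, x \in l -> S s -> F (val [~ x, s]%g)) ->
  {in l &, forall x y, x != y -> exists2 s, S s & [~ x, s]%g <> [~ y, s]%g} ->
  (size l <= \dim {:D})%N.
Proof.
move=> FB FM FC FS FK ul Fl sep.
pose X := in_tuple (map val l : seq D).
suff : free (map val l : seq D).
  by rewrite /free size_map => /eqP <-; apply: dimvS; exact: subvf.
apply/(@freeP _ _ _ X) => k sum0 i.
have Xl : size X = size l by rewrite size_tuple size_map.
(* Since [l] has no repetition, the coefficients indexed by positions can be read as a function of
   the element, set to 0 outside [l]. *)
pose f x : D := if insub (index x l) is Some j
  then (k (cast_ord (esym (size_map val l)) j))%:A else 0.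
pose x := tnth (in_tuple l) (cast_ord (size_map val l) i).
have xl : x \in l by exact: mem_tnth.
have fE (j : 'I_(size l)) : f (tnth (in_tuple l) j) =
    (k (cast_ord (esym (size_map val l)) j))%:A.
  rewrite /f (tnth_nth 1%g) index_uniq //= insubT //= => lt.
  by congr ((k _)%:A); apply: val_inj.
have : f x = 0.
  apply: (separated_free FB FM FC FS ul Fl sep) xl => [y _|].
    rewrite /f; case: insubP => [j _ _|_]; first exact: FK.
    by have := FK 0; rewrite scale0r.
  rewrite (big_tnth _ _ l) -[RHS]sum0 (reindex (cast_ord (size_map val l))) /=.
    apply: eq_bigr => j _; rewrite fE cast_ordK mulr_algr.
    by rewrite (tnth_nth 1%g) /= (nth_map 1%g) // -(size_map val).
  by exists (cast_ord (esym (size_map val l))) => y _; rewrite ?cast_ordK ?cast_ordKV.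
rewrite fE cast_ordK => /eqP; rewrite scaler_eq0 oner_eq0 orbF => /eqP //.
Qed.

(** Commuting with a set is commuting with its span, and a finite part of [M] whose span has maximal
    dimension has all of [M] in its span. *)
Lemma finite_centralizing_subset M :
  exists2 s : seq Du, (forall u, u \in s -> M u) &
    forall x, (forall u, u \in s -> val u * x = x * val u) ->
    forall m, M m -> val m * x = x * val m.
Proof.
pose span_s (s : seq Du) := (<<map val s>>%VS : {vspace D}).
have [||s sM max] := @exists_maximum _ (fun s => forall u, u \in s -> M u)
  (fun s => \dim (span_s s)) (\dim {:D}).
- by exists [::].
- by move=> s _; apply/dimvS/subvf.
exists s => // x cx m Mm.
have sub : (span_s s <= span_s (m :: s))%VS by rewrite /span_s /= span_cons addvSr.
have : span_s s == span_s (m :: s).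
  rewrite eqEdim sub; apply: max => u; rewrite inE => /predU1P[->|/sM] //.
move=> /eqP e; have ms : val m \in span_s s.
  by rewrite e /span_s /= memv_span ?inE ?eqxx.
apply/cent1vP; apply: subvP ms; apply/span_subvP => _ /mapP[u us ->].
by apply/cent1vP; exact: cx.
Qed.

(** Local nilpotency only reaches finitely generated subgroups. If no such [a] existed, each
    noncentral member of a finite maximal list [l] would have a witness against it. These witnesses
    and [s0] generate a nilpotent [H], and a noncentral element of the second center of [H] equals
    some [x] in [l] up to a factor centralizing [M], contradicting the witness of [x]. *)
Lemma locally_nilpotent_second_center M : is_subgroup M ->
  locally_nilpotent M -> ~ (M `<=` centralizer M) ->
  exists a, [/\ M a, ~ centralizer M a &
    forall n, M n -> centralizer M [~ a, n]%g].
Proof.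
move=> sM lnM nab; have [M1 MM MV] := sM.
have [s0 s0M cs0] := finite_centralizing_subset M.
have cs0P u : (forall s, s \in s0 -> commute u s) -> centralizer M u.
  move=> cu; apply/centralizerP => m Mm; apply/esym/cs0 => // s ss.
  by have /(congr1 val) := cu s ss.
(* The commutators with [s0] are the characters that tell the members of [l] apart; their
   independence bounds the length of [l]. *)
pose P (l : seq Du) := [/\ uniq l, forall x, x \in l -> M x,
  forall x s, x \in l -> s \in s0 -> centralizer M [~ x, s]%g &
  {in l &, forall x y, x != y -> exists2 s, s \in s0 & [~ x, s]%g <> [~ y, s]%g}].
pose C x := forall m, M m -> x * val m = val m * x.
(* [F] is the center of the centralizer [C] of [M] in [D]: it is commutative and contains both [K]
   and the commutators of [l] with [s0]. *)
pose F : set D := [set x | C x /\ forall y, C y -> x * y = y * x].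
have [||l [ul lM lC lsep] max] := @exists_maximum _ P size (\dim {:D}).
- by exists [::].
- move=> l [ul lM lC lsep]; apply: (@size_separated F [set s | s \in s0]) => //.
  + move=> x y [xM xC] [yM yC]; split=> [m Mm|z Cz].
      by rewrite mulrBl mulrBr xM ?yM.
    by rewrite mulrBl mulrBr xC ?yC.
  + move=> x y [xM xC] [yM yC]; split=> [m Mm|z Cz].
      by rewrite -mulrA yM // mulrA xM // mulrA.
    by rewrite -mulrA yC // mulrA xC // mulrA.
  + by move=> x y [xM xC] [yM yC]; exact: xC.
  + by move=> x s [xM _] /s0M; exact: xM.
  + by move=> k; split=> [m _|y _]; rewrite mulr_algl mulr_algr.
  + move=> x s xl ss; split=> [m Mm|y Cy].
      exact: (centralizerP M _).1 (lC _ _ xl ss) m Mm.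
    by apply/esym/Cy/(subgroup_comm sM); [exact: lM|exact: s0M].
apply: contrapT => none.
have /choice[nx nxP] : forall x, exists n,
    M x -> ~ centralizer M x -> M n /\ ~ centralizer M [~ x, n]%g.
  move=> x; apply: contrapT => nn; apply: nn.
  have [[Mx ncx]|] := pselect (M x /\ ~ centralizer M x); last first.
    by move=> h; exists 1%g => Mx ncx; case: h.
  apply: contrapT => nn; apply: none; exists x; split=> // n Mn.
  by apply: contrapT => nc; apply: nn; exists n.
pose S := s0 ++ [seq nx x | x <- l & `[< ~ centralizer M x >]].
have SM : [set` S] `<=` M.
  move=> x /=; rewrite mem_cat => /orP[/s0M //|/mapP[y + ->]].
  by rewrite mem_filter => /andP[/asboolP ncy /lM My]; case: (nxP y My ncy).
pose H := generated [set` S].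
have sH : is_subgroup H := generated_subgroup _.
have HM : H `<=` M by exact: generated_sub.
have SH x : x \in S -> H x by move=> xS; exact: sub_generated.
have s0H s : s \in s0 -> H s by move=> ss; apply: SH; rewrite mem_cat ss.
have cHM u : centralizer H u -> centralizer M u.
  by move=> cu; apply: cs0P => s /s0H; exact: cu.
have [||z [Hz ncz zH]] := nilpotent_second_center sH.
- by apply: lnM => //; exact: finite_seq.
- move=> abH; apply: nab => m Mm; apply: cs0P => s ss; apply/commute_sym.
  exact: (cHM _ (abH s (s0H s ss))).
have Mz := HM _ Hz.
have nczM : ~ centralizer M z by move=> cz; apply: ncz => h /HM; exact: cz.
(* By maximality of [l]: otherwise [z :: l] would satisfy [P]. *)
have [x xl xz] : exists2 x, x \in l & forall s, s \in s0 -> [~ x, s]%g = [~ z, s]%g.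
  apply: contrapT => sepz.
  have {}sepz x : x \in l -> exists2 s, s \in s0 & [~ x, s]%g <> [~ z, s]%g.
    move=> xl; apply: contrapT => nn; apply: sepz; exists x => // s ss.
    by apply: contrapT => ne; apply: nn; exists s.
  suff /max : P (z :: l) by rewrite /= ltnn.
  split.
  - rewrite /= ul andbT; apply/negP => /sepz[s _]; exact.
  - by move=> x; rewrite inE => /predU1P[->|/lM].
  - move=> x s; rewrite inE => /predU1P[-> ss|xl]; last exact: lC.
    by apply: cHM; apply: zH; exact: s0H.
  move=> x y; rewrite !inE => /predU1P[->|xl] /predU1P[->|yl].
  - by rewrite eqxx.
  - by move=> _; have [s ss ne] := sepz _ yl; exists s => // /esym.
  - by move=> _; exact: sepz.
  - exact: lsep.
have Mx := lM _ xl.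
(* [x] and [z] conjugate each element of [s0] alike, so [z * x^-1] centralizes [s0], hence [M]. *)
have cg : centralizer M (z * x^-1)%g.
  apply: cs0P => s ss; apply/commute_sym/commgP; rewrite -conjg_fix conjgM.
  move: (xz s ss); rewrite !commgEr => /mulIg; rewrite !conjVg => /invg_inj <-.
  by rewrite conjgK.
set g := (z * x^-1)%g in cg.
have zE : z = (g * x)%g by rewrite mulgVK.
have ncx : ~ centralizer M x.
  move=> cx; apply: nczM => m Mm; rewrite zE; apply/commute_sym/commuteM.
    exact/commute_sym/cg.
  exact/commute_sym/cx.
have [Mn] := nxP x Mx ncx; apply.
have -> : [~ x, nx x]%g = [~ z, nx x]%g.
  rewrite zE !commgEl conjMg invgM.
  have /eqP -> : (g ^ nx x)%g == g by rewrite conjg_fix; apply/commgP/cg.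
  by rewrite -mulgA mulKg.
apply: cHM; apply: zH; apply: SH; rewrite mem_cat; apply/orP; right.
by apply: map_f; rewrite mem_filter xl andbT; apply/asboolP.
Qed.

(** The hypotheses give [a * u = c * (u * a)] with [c] commuting with [a], for [u = m] and
    [u = 1 + m], which is the input of Hua's trick. *)
Lemma commute_of_commute_comm1D (a m p : Du) : val p = 1 + val m ->
  commute [~ a, m]%g a -> commute [~ a, m]%g m ->
  commute [~ a, p]%g a -> commute [~ a, p]%g p -> commute a m.
Proof.
move=> pE cma cmm cpa cpp.
have swap u : commute [~ a, u]%g a -> commute [~ a, u]%g u ->
    val a * val u = val [~ a, u]%g * (val u * val a).
  move=> ca cu; rewrite -!ug_valM [in LHS]commgC; congr (val _).
  exact/esym/commuteM.
apply: val_inj; rewrite !ug_valM.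
apply: (commute_of_semicommute1D (ug_neq0 a) (swap _ cma cmm)).
- by rewrite -pE; exact: (swap _ cpa cpp).
- by rewrite -!ug_valM cma.
- by rewrite -!ug_valM cpa.
Qed.

Lemma noncommute_unit1D (a m : Du) : ~ commute a m ->
  exists p : Du, val p = 1 + val m.
Proof.
move=> am; have [m1|m1] := eqVneq (1 + val m) 0; last by exists (division_unit m1).
case: am; apply: val_inj; rewrite !ug_valM.
have -> : val m = -1 by apply: (addrI 1); rewrite m1 subrr.
by rewrite mulrN1 mulN1r.
Qed.

(** * Scalars, bicentralizers and maximality *)

Lemma central_scalar (x : D) : central_algebra D ->
  (forall y, x * y = y * x) -> exists k : K, x = k%:A.
Proof.
move=> cD cx; apply/vlineP; rewrite -cD memv_cap memvf.
by apply/centvP => y _; exact: cx.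
Qed.

Lemma scalar_commute u m (k : K) : val u = k%:A -> commute u m.
Proof.
by move=> uE; apply: val_inj; rewrite !ug_valM uE mulr_algl mulr_algr.
Qed.

(** The units [E] of the bicentralizer of [M] contain [M]. If [E] is everything, all that
    centralizes [M] is central. If [E = M], then [M] contains [1 + m] for some [m] in [M] not
    commuting with [a], against Hua's trick. *)
Lemma maximal_centralizer_scalar M a : central_algebra D ->
  maximal_subgroup M -> M a -> ~ centralizer M a ->
  (forall n, M n -> centralizer M [~ a, n]%g) ->
  forall c, centralizer M c -> exists k : K, val c = k%:A.
Proof.
move=> cD [sM _ maxM] Ma nca caM.
pose E := unit_centralizer [set x | forall m, M m -> val m * x = x * val m].
have ME : M `<=` E by move=> m Mm x; exact.
have sE : is_subgroup E := unit_centralizer_subgroup _.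
have [ET|ET] := pselect (E = [set: Du]).
  move=> c /centralizerP cc; apply: central_scalar => // y.
  have [->|y0] := eqVneq y 0; first by rewrite mulr0 mul0r.
  have : E (division_unit y0) by rewrite ET.
  by move=> Ey; apply/esym/Ey => m Mm; rewrite cc.
have EM := maxM E sE ME ET.
have [m /not_implyP[Mm nam]] := (existsNP _).2 nca.
have [p pE] := noncommute_unit1D nam.
have Mp : M p.
  rewrite -EM => x cx; rewrite pE mulrDl mulrDr mul1r mulr1.
  by rewrite (ME _ Mm).
by case: nam; apply: (commute_of_commute_comm1D pE); apply: caM.
Qed.

(** Conjugation by [n] multiplies [a] by a scalar, so it preserves the centralizer of [a], hence
    also the bicentralizer. *)
Lemma bicentralizer_conj (a n l : Du) (k : K) : val [~ a, n]%g = k%:A ->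
  unit_centralizer [set x | val a * x = x * val a] l ->
  unit_centralizer [set x | val a * x = x * val a] (l ^ n)%g.
Proof.
move=> kE Ll y ya.
have an : val a * val n = val n * (k *: val a).
  rewrite -ug_valM commgC (ug_valM (n * a)%g) (ug_valM n) kE mulr_algr.
  exact: scalerAr.
have na : (val n)^-1 * val a = k *: val a * (val n)^-1.
  apply: (mulrI (ugP n)); apply: (mulIr (ugP n)).
  by rewrite mulrA mulrV ?ugP // mul1r an -!mulrA mulVr ?ugP // mulr1.
have cy : val l * (val n * y * (val n)^-1) = val n * y * (val n)^-1 * val l.
  apply: Ll; rewrite /= !mulrA an -!mulrA na -!scalerAl -!scalerAr.
  by congr (_ *: (_ * _)); rewrite !mulrA ya.
rewrite conjgE !ug_valM ug_valV.
apply: (mulrI (ugP n)); apply: (mulIr (ugP n^-1%g)); rewrite ug_valV.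
by move: cy; rewrite !mulrA mulrV ?ugP // mul1r => ->; rewrite mulrK ?ugP.
Qed.

(** [M] normalizes [L]. If [L] is not inside [M], every unit is a product from [L] and [M], so it
    conjugates [a] to a scalar multiple; Hua's trick for [m] and [1 + m] then makes [a] and [m]
    commute. *)
Lemma maximal_bicentralizer_sub M a m : maximal_subgroup M -> M m ->
  ~ commute a m ->
  (forall n, M n -> exists k : K, val [~ a, n]%g = k%:A) ->
  unit_centralizer [set x | val a * x = x * val a] `<=` M.
Proof.
move=> maxM Mm nam scal.
set L := unit_centralizer _; have sL : is_subgroup L := unit_centralizer_subgroup _.
have nLM l n : L l -> M n -> L (l ^ n)%g.
  by move=> Ll Mn; have [k kE] := scal n Mn; exact: bicentralizer_conj kE Ll.
have [//|LM] := maximal_subgroup_mul maxM sL nLM.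
have all_scal x : exists k : K, val [~ a, x]%g = k%:A.
  have [l [n [Ll Mn ->]]] := LM x; rewrite commgEl conjgM.
  have /eqP -> : (a ^ l)%g == a.
    rewrite conjg_fix; apply/commgP/commute_sym/val_inj.
    by rewrite !ug_valM Ll.
  exact: scal.
have [p pE] := noncommute_unit1D nam.
have [k kE] := all_scal m; have [k' kE'] := all_scal p.
case: nam; apply: (commute_of_commute_comm1D pE);
  by apply: scalar_commute; eassumption.
Qed.

Lemma scalar_comm_expn a m (k : K) i : val [~ a, m]%g = k%:A ->
  val [~ a ^+ i, m]%g = (k ^+ i)%:A.
Proof.
move=> kE; rewrite commgEl conjXg -[(a ^ m)%g](mulVKg a) -commgEl.
rewrite expgMn; last exact/commute_sym/(scalar_commute a kE).
by rewrite mulKg ug_valX kE exprZn expr1n.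
Qed.

(** If all powers of [k] were distinct, the powers of [a] would have distinct commutators with [m]
    and be linearly independent over [K]. *)
Lemma scalar_comm_finite_order a m (k : K) : val [~ a, m]%g = k%:A ->
  exists2 n, (0 < n)%N & k ^+ n = 1.
Proof.
move=> kE; apply: contrapT => inf.
have k0 : k != 0.
  by apply: contraNneq (ug_neq0 [~ a, m]%g) => k0; rewrite kE k0 scale0r.
have inj_lt i j : (i < j)%N -> k ^+ i <> k ^+ j.
  move=> ij e; apply: inf; exists (j - i)%N; rewrite ?subn_gt0 //.
  apply: (mulfI (expf_neq0 i k0)); rewrite -exprD subnKC ?mulr1 //; exact: ltnW.
have inj_k i j : k ^+ i = k ^+ j -> i = j.
  move=> e; case: (ltngtP i j) => // /inj_lt; [by []|by case].
have inj_a i j : [~ a ^+ i, m]%g = [~ a ^+ j, m]%g -> i = j.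
  move=> /(congr1 val); rewrite !(scalar_comm_expn _ kE) => e; apply: inj_k.
  apply/eqP; rewrite -subr_eq0; move/eqP: e.
  by rewrite -subr_eq0 -scalerBl scaler_eq0 oner_eq0 orbF.
suff : (size [seq (a ^+ i)%g | i <- iota 0 (\dim {:D}).+1] <= \dim {:D})%N.
  by rewrite size_map size_iota ltnn.
apply: (@size_separated (range (fun k : K => k%:A)) [set m]).
- by move=> _ _ [x _ <-] [y _ <-]; exists (x - y); rewrite // scalerBl.
- move=> _ _ [x _ <-] [y _ <-]; exists (x * y) => //.
  by rewrite mulr_algl scalerA.
- by move=> _ _ [x _ <-] [y _ <-]; rewrite mulr_algl mulr_algr.
- by move=> _ s [x _ <-] _; rewrite mulr_algl mulr_algr.
- by move=> x; exists x.
- by rewrite map_inj_uniq ?iota_uniq // => i j e; apply: inj_a; rewrite e.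
- by move=> _ _ /mapP[i _ ->] ->; exists (k ^+ i) => //; rewrite (scalar_comm_expn _ kE).
move=> _ _ /mapP[i _ ->] /mapP[j _ ->] ij; exists m => // /inj_a e.
by rewrite e eqxx in ij.
Qed.

End DivisionAlgebra.

(** * Valuations *)

Section ValuationLemmas.
Variables (G : orderedZmodType) (R : nzRingType) (w : valuation G R).
Implicit Types x y : R.

Lemma vltNge (a b : option G) : vlt a b = ~~ vle b a. Proof. by []. Qed.

Lemma val_addr x y : vlt (w x) (w y) -> w (x + y) = w x.
Proof.
move=> xy; have xyP : vle (w x) (w (x + y)).
  by apply: vle_trans (val_geD w _ _); rewrite vle_min vlexx vlt_le.
have : vle (vmin (w (x + y)) (w (- y))) (w x).
  by rewrite -[in X in vle _ X](addrK y x); exact: val_geD.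
rewrite valN /vmin; case: ifP => _; last first.
  by move=> /vle_lt_trans /(_ xy); rewrite /vlt vlexx.
move: xyP; case: (w (x + y)) (w x) => [a|] [b|] //= ba ab.
by congr Some; apply: le_anti; rewrite ab.
Qed.

Lemma vle0_val_add x y : vle (Some 0) (w x) -> vle (Some 0) (w y) ->
  vle (Some 0) (w (x + y)).
Proof.
by move=> x0 y0; apply: vle_trans (val_geD w _ _); rewrite vle_min x0.
Qed.

Lemma vlt0_val_add x y : vlt (Some 0) (w x) -> vlt (Some 0) (w y) ->
  vlt (Some 0) (w (x + y)).
Proof.
move=> x0 y0; have : vlt (Some 0) (vmin (w x) (w y)) by rewrite vlt_min x0.
by rewrite !vltNge; apply: contraNN; exact: vle_trans (val_geD w _ _).
Qed.

Lemma vle0_val_mul x y : vle (Some 0) (w x) -> vle (Some 0) (w y) ->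
  vle (Some 0) (w (x * y)).
Proof. by move=> x0 y0; have := vaddS_le x0 y0; rewrite addr0 Defs.valM. Qed.

Lemma vle0_val_nat n : vle (Some 0) (w n%:R).
Proof.
elim: n => [|n IHn]; first by rewrite mulr0n val0.
by rewrite mulrSr; apply: vle0_val_add; rewrite ?Defs.val1 ?vlexx.
Qed.

Lemma val_1D x : vlt (Some 0) (w x) -> w (1 + x) = Some 0.
Proof. by move=> x0; rewrite val_addr Defs.val1. Qed.

(** Binomial expansion to first order; all that is kept of the rest is that [y] has nonnegative
    value. *)
Lemma expr1D_trunc x n : vle (Some 0) (w x) ->
  exists2 y, vle (Some 0) (w y) & (1 + x) ^+ n = 1 + n%:R * x + x ^+ 2 * y.
Proof.
move=> x0; elim: n => [|n [y y0 IHn]].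
  by exists 0; rewrite ?val0 // expr0 mul0r mulr0 !addr0.
exists (n%:R + (y + y * x)).
  apply: vle0_val_add; first exact: vle0_val_nat.
  by apply: vle0_val_add => //; exact: vle0_val_mul.
have e : n%:R * x * x = x ^+ 2 * n%:R.
  by rewrite -mulrA -expr2 mulr_natl mulr_natr.
rewrite exprSr IHn mulrDr mulr1 [(_ + _ + _) * x]mulrDl [(_ + _) * x]mulrDl mul1r e.
rewrite mulrSr mulrDl mul1r !mulrDr mulrA -!addrA; congr (1 + (_ + _)).
by rewrite [LHS]addrCA; congr (_ + _); rewrite addrCA.
Qed.

(** Since [r] has smaller value than [x], the linear term [r%:R * x] dominates the terms of higher
    order. *)
Lemma val_expn1D_sub1 x r rho g : w r%:R = Some rho -> w x = Some g ->
  0 < g -> rho < g -> w ((1 + x) ^+ r - 1) = Some (rho + g).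
Proof.
move=> wr wx g0 rg.
have [|y y0 ->] := expr1D_trunc r (x := x); first by rewrite wx /=; exact: ltW.
rewrite -(addrA 1) [1 + _]addrC addrK val_addr; rewrite Defs.valM wr wx //=.
rewrite expr2 -mulrA Defs.valM Defs.valM wx.
case: (w y) y0 => [h|] //= h0.
rewrite /vlt /= -oz_ltNge; apply: (@lt_le_trans _ _ (g + g)).
  by rewrite oz_ltD2r.
by rewrite oz_leD2l -{1}[g]addr0 oz_leD2l.
Qed.

(** Taking an [r]-th power replaces [x] by an element of value [rho + g], at least [g], so the
    hypotheses persist and the value stays finite after [s] steps. *)
Lemma expn1D_neq1 x r s rho g : w r%:R = Some rho -> w x = Some g ->
  0 < g -> rho < g -> (1 + x) ^+ (r ^ s) <> 1.
Proof.
move=> wr + g0 rg.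
have rho0 : 0 <= rho by have := vle0_val_nat r; rewrite wr.
suff : forall g x, w x = Some g -> 0 < g -> rho < g ->
    exists h, w ((1 + x) ^+ (r ^ s) - 1) = Some h.
  by move=> H wx e; have [h] := H _ _ wx g0 rg; rewrite e subrr val0.
elim: s => [|s IHs] {}g {}x {g0 rg} wx g0 rg.
  by exists g; rewrite expr1 addrC addKr.
have e := val_expn1D_sub1 wr wx g0 rg.
rewrite expnS exprM -[(1 + x) ^+ r](subrKC 1).
have gle : g <= rho + g by rewrite -{1}[g]add0r oz_leD2r.
by apply: IHs e _ _; apply: lt_le_trans gle.
Qed.

End ValuationLemmas.

(** * Making values positive by scalar multiplication *)

Section Scaling.
Variables (G : orderedZmodType) (K : fieldType) (D : falgType K).
Variable w : valuation G D.
Hypothesis D_division : division_algebra D.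
Implicit Types (b : D) (k t : K).

Lemma val_neq0 b : b != 0 -> exists g, w b = Some g.
Proof.
move=> b0; case e: (w b) => [g|]; first by exists g.
by move/val_inftyP/eqP: e; rewrite (negPf b0).
Qed.

Lemma valV b g : w b = Some g -> w b^-1 = Some (- g).
Proof.
move=> wb; have b0 : b != 0 by apply/eqP => b0; rewrite b0 val0 in wb.
have := Defs.valM w b b^-1; rewrite mulrV ?D_division // Defs.val1 wb.
case: (w b^-1) => //= h [e]; congr Some.
by apply: (addrI g); rewrite -e subrr.
Qed.

Lemma alg_neq0 k : k != 0 -> k%:A != 0 :> D.
Proof. by move=> k0; rewrite scaler_eq0 oner_eq0 orbF. Qed.

Lemma scale_valE k b : w (k *: b) = vadd (w k%:A) (w b).
Proof. by rewrite -Defs.valM mulr_algl. Qed.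

(** The powers of [b] with exponents from 0 to [\dim {:D}] are one too many to be independent. *)
Lemma algebraic_root b : exists2 p : {poly K}, p != 0 & horner_alg b p = 0.
Proof.
pose n := (\dim {:D}).+1; pose X := [tuple b ^+ i | i < n].
have nfree : ~ free X.
  move=> /eqP e; have : (\dim <<X>> <= \dim {:D})%N by apply/dimvS/subvf.
  by rewrite e size_tuple ltnn.
have /existsNP[c /not_implyP[sum0 /existsNP[i ci]]] :
    ~ forall c : 'I_n -> K, \sum_(i < n) c i *: X`_i = 0 -> forall i, c i = 0.
  by move=> h; apply: nfree; exact/freeP.
exists (\sum_(i < n) c i *: 'X^i).
  apply: contra_notN ci => /eqP /(congr1 (fun p : {poly K} => p`_i)).
  rewrite coef0 coef_sum (bigD1 i) //= coefZ coefXn eqxx mulr1 big1 ?addr0 //.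
  move=> j ji; rewrite coefZ coefXn; case: eqP => [e|_]; last by rewrite mulr0.
  by move/val_inj: e ji => ->; rewrite eqxx.
rewrite linear_sum -[RHS]sum0; apply: eq_bigr => j _.
have -> : X`_j = b ^+ j by rewrite -tnth_nth tnth_mktuple.
by rewrite linearZ /= rmorphXn /= horner_algX mulr_algl.
Qed.

(* If the values of K were bounded above by w b, the terms of a polynomial in b
   would have strictly increasing values, so b could not be algebraic over K. *)
Lemma scalar_val_ge b g : w b = Some g -> 0 < g ->
  exists t h, [/\ t != 0, w t%:A = Some h & g <= h].
Proof.
move=> wb g0; apply: contrapT => none.
have bnd t h : t != 0 -> w t%:A = Some h -> h < g.
  by move=> t0 wt; rewrite oz_ltNge; apply/negP => gh; apply: none; exists t, h.
(* The induction takes for [k] the lowest nonzero coefficient of [p]; the point is that [p] at [b]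
   has finite value. *)
suff low (p : {poly K}) : p != 0 ->
    exists k h h',
      [/\ k != 0, w k%:A = Some h, w (horner_alg b p) = Some h' & h <= h'].
  have [p p0 pb] := algebraic_root b; have [k [h [h' [_ _]]]] := low p p0.
  by rewrite pb val0.
elim/poly_ind: p => [|p c IHp]; first by rewrite eqxx.
rewrite rmorphD rmorphM /= horner_algX horner_algC.
have [->|p0] := eqVneq p 0.
  rewrite mul0r add0r rmorph0 mul0r add0r polyC_eq0 => c0.
  by have [h wc] := val_neq0 (alg_neq0 c0); exists c, h, h.
have [k [h [h' [k0 wk wp hh']]]] := IHp p0.
have wpb : w (horner_alg b p * b) = Some (h' + g) by rewrite Defs.valM wp wb.
have h_lt : h < h' + g.
  by apply: (le_lt_trans hh'); rewrite -{1}[h']addr0 oz_ltD2l.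
have [->|c0] := eqVneq c 0.
  by exists k, h, (h' + g); rewrite scale0r addr0; split=> //; exact: ltW.
have [hc wc] := val_neq0 (alg_neq0 c0); exists c, hc, hc; split=> //.
rewrite addrC val_addr // wc wpb /vlt /= -oz_ltNge.
(* The bound on values of scalars, applied to [c / k], puts the value of [c] below that of the other
   summand. *)
have : hc - h < g.
  apply: (bnd (c / k)); first by rewrite mulf_neq0 ?invr_neq0.
  have -> : (c / k)%:A = c%:A * (k%:A)^-1 :> D.
    by rewrite -[c%:A]/(in_alg D c) -[k%:A]/(in_alg D k) -fmorphV -rmorphM.
  by rewrite Defs.valM wc (valV wk).
rewrite -(oz_ltD2r h (hc - h)) subrK => hcg; apply: lt_le_trans hcg _.
by rewrite addrC oz_leD2r.
Qed.

Hypothesis w_nontrivial : exists2 k, k != 0 & w k%:A <> Some 0.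

Lemma scalar_val_gt0 : exists t h, [/\ t != 0, w t%:A = Some h & 0 < h].
Proof.
have [k k0 wk] := w_nontrivial; have [h wkh] := val_neq0 (alg_neq0 k0).
have h0 : h != 0 by apply/eqP => h0; apply: wk; rewrite wkh h0.
have [hpos|hneg] := boolP (0 < h); first by exists k, h.
exists k^-1, (- h); split; first by rewrite invr_neq0.
  by rewrite -[_%:A]/(in_alg D _) fmorphV /=; exact: valV.
rewrite -(oz_ltD2r h) add0r addNr lt_neqAle h0 /=.
by rewrite oz_leNgt.
Qed.

Lemma scale_val_gt0 b : exists2 t, t != 0 & vlt (Some 0) (w (t *: b)).
Proof.
have [t [e [t0 wt e0]]] := scalar_val_gt0.
have [->|b0] := eqVneq b 0; first by exists t; rewrite // scaler0 val0.
have [g wb] := val_neq0 b0.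
have [g0|g0] := boolP (0 <= g).
  exists t; rewrite // scale_valE wt wb /vlt /= -oz_ltNge.
  by apply: (lt_le_trans e0); rewrite -{1}[e]addr0 oz_leD2l.
have ng0 : 0 < - g by rewrite -(oz_ltD2r g) add0r addNr oz_ltNge.
(* [s] makes up for the negative value of [b]; the factor [t] then makes the total positive. *)
have [s [h [s0 ws gh]]] := scalar_val_ge (valV wb) ng0.
exists (t * s); first exact: mulf_neq0.
rewrite -scalerA (scale_valE t) (scale_valE s) wt ws wb /vlt /= -oz_ltNge.
apply: (lt_le_trans e0); rewrite -{1}[e]addr0 oz_leD2l.
by rewrite -(oz_leD2r (- g)) add0r addrK.
Qed.

Lemma scale_val_gt0_pair b c : exists t,
  [/\ t != 0, vlt (Some 0) (w (t *: b)) & vlt (Some 0) (w (t *: c))].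
Proof.
wlog bc : b c / vle (w b) (w c).
  move=> H; have /orP[/H //|/H[t [t0 tc tb]]] := vle_total (w b) (w c).
  by exists t.
have [t t0 tb] := scale_val_gt0 b; exists t; split=> //.
move: tb; rewrite !vltNge; apply: contraNN; apply: vle_trans.
rewrite (scale_valE t b) (scale_valE t c); have [h ->] := val_neq0 (alg_neq0 t0).
by move: bc; case: (w b) (w c) => [x|] [y|] //=; rewrite oz_leD2l.
Qed.

End Scaling.

(** * The graded ring *)

Section GradedLemmas.
Variables (G : orderedZmodType) (K : fieldType) (D : falgType K).
Variable w : valuation G D.
Hypothesis D_division : division_algebra D.
Local Notation Du := (unit_group D).
Implicit Types (u m : Du) (M : set Du).

Definition one_units : set Du := [set u | vlt (Some 0) (w (val u - 1))].

Lemma val_one_unit u : one_units u -> w (val u) = Some 0.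
Proof. by move=> /val_1D; rewrite subrKC. Qed.

Lemma one_units_subgroup : is_subgroup one_units.
Proof.
split=> [|x y Ux Uy|x Ux]; rewrite /one_units /=.
- by rewrite subrr val0.
- rewrite (_ : _ - 1 = (val x - 1) * val y + (val y - 1)); last first.
    by rewrite mulrBl mul1r addrA subrK.
  apply: vlt0_val_add => //; rewrite Defs.valM (val_one_unit Uy).
  by move: Ux; rewrite /one_units /=; case: (w _) => //= g; rewrite addr0.
- rewrite (_ : _ - 1 = - ((val x)^-1 * (val x - 1))); last first.
    by rewrite mulrBr mulVr ?ugP // mulr1 opprB.
  rewrite valN Defs.valM (valV D_division (val_one_unit Ux)) oppr0.
  by move: Ux; rewrite /one_units /=; case: (w _) => //= g; rewrite add0r.
Qed.

Lemma one_units_conj u m : one_units u -> one_units (u ^ m)%g.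
Proof.
suff e : w (val (u ^ m)%g - 1) = w (val u - 1) by rewrite /one_units /mkset e.
have -> : val (u ^ m)%g - 1 = (val m)^-1 * (val u - 1) * val m.
  by rewrite mulrBr mulr1 mulrBl mulVr ?ugP // -mulrA.
have [g wm] := val_neq0 w (ug_neq0 m).
rewrite !Defs.valM (valV D_division wm) wm.
by case: (w _) => //= h; rewrite addrAC addNr add0r.
Qed.

Lemma gr_hom_eq g (x y : D) : vle (Some g) (w x) -> vle (Some g) (w y) ->
  vlt (Some g) (w (x - y)) -> gr_hom w g x = gr_hom w g y.
Proof.
move=> gx gy gxy; apply: gr_ext => h; rewrite !gr_homE.
by case: eqP => // ->; apply/eqP; rewrite gr_cls_eq.
Qed.

(** A unit [u * m] with [u] a 1-unit has the same class as [m]. So the nonzero homogeneous elements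
    are classes of commuting elements of [M], and they generate [gr w] additively. *)
Lemma gr_commutative M : (forall x y, M x -> M y -> commute x y) ->
  (forall x, exists u m, [/\ one_units u, M m & x = (u * m)%g]) ->
  forall x y : gr w, x * y = y * x.
Proof.
move=> cM UM.
have homM g (x : D) : vle (Some g) (w x) ->
    gr_hom w g x = 0 \/
    exists m, [/\ M m, w (val m) = Some g & gr_hom w g x = gr_hom w g (val m)].
  move=> gx; have [gx'|] := boolP (vlt (Some g) (w x)).
    left; rewrite (@gr_hom_eq g x 0) ?val0 ?subr0 //.
    by apply: gr_ext => h; rewrite gr_homE gr0E gr_cls0; case: ifP.
  rewrite /vlt negbK => xg; right.
  have wx : w x = Some g.
    move: gx xg; case: (w x) => [h|] //= h1 h2; congr Some.
    by apply: le_anti; rewrite h1 h2.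
  have x0 : x != 0 by apply/eqP => x0; rewrite x0 val0 in wx.
  have [u [m [Uu Mm e]]] := UM (division_unit D_division x0).
  have {}e : x = val u * val m by rewrite -ug_valM -e.
  have wm : w (val m) = Some g.
    move: wx; rewrite e Defs.valM (val_one_unit Uu).
    by case: (w _) => //= h; rewrite add0r.
  (* The difference [x - m = (u - 1) * m] has value above [g]. *)
  exists m; split=> //; apply: gr_hom_eq; rewrite ?wx ?wm ?vlexx //.
  rewrite e -[X in _ - X]mul1r -mulrBl Defs.valM wm.
  move: Uu; rewrite /one_units /=; case: (w _) => //= h.
  by rewrite /vlt /= -!oz_ltNge => h0; rewrite -{1}[g]add0r oz_ltD2r.
move=> x y; elim/gr_ind: x => [|g a x ga IHx]; first by rewrite mul0r mulr0.
rewrite mulrDl mulrDr IHx; congr (_ + _); clear IHx.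
elim/gr_ind: y => [|h b y hb IHy]; first by rewrite mul0r mulr0.
rewrite mulrDl mulrDr IHy; congr (_ + _); clear IHy.
have [->|[m [Mm wm ->]]] := homM _ _ ga; first by rewrite mul0r mulr0.
have [->|[n [Mn wn ->]]] := homM _ _ hb; first by rewrite mul0r mulr0.
rewrite !gr_homM ?wm ?wn ?vlexx // addrC; congr (gr_hom w _ _).
by rewrite -!ug_valM cM.
Qed.

(** If two basis elements [e i0] and [e i1] are the images of [a0] and [a1], then
    [a0 * e i1 = a1 * e i0] by commutativity. Uniqueness of coordinates gives [a0 = 0], so
    [e i0 = 0], which is impossible in a basis. *)
Lemma gr_rank_le1 (n : nat) : (forall x y : gr w, x * y = y * x) ->
  gr_rank w n ->
  (forall z, exists c, z = gr_incl (in_alg D) w c) -> (n <= 1)%N.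
Proof.
move=> comm_gr [e [_ basis]] onto; rewrite leqNgt; apply/negP => n1.
have n0 : (0 < n)%N by exact: ltnW.
pose i0 := Ordinal n0; pose i1 := Ordinal n1.
have uniq_coef (c d : {ffun 'I_n -> gr (val_restr (in_alg D) w)}) :
    \sum_(i < n) gr_incl (in_alg D) w (c i) * e i =
    \sum_(i < n) gr_incl (in_alg D) w (d i) * e i -> c = d.
  move=> cd; have [b [_ ub]] := basis (\sum_(i < n) gr_incl (in_alg D) w (c i) * e i).
  by rewrite -(ub c erefl) -(ub d cd).
pose delta i a : {ffun 'I_n -> gr (val_restr (in_alg D) w)} :=
  [ffun j => if j == i then a else 0].
have sum_delta i a : \sum_(j < n) gr_incl (in_alg D) w (delta i a j) * e j =
    gr_incl (in_alg D) w a * e i.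
  rewrite (bigD1 i) //= big1 ?addr0 => [|j ji]; first by rewrite ffunE eqxx.
  by rewrite ffunE (negPf ji) rmorph0 mul0r.
have [a0 e0] := onto (e i0); have [a1 e1] := onto (e i1).
have a00 : a0 = 0.
  have : delta i1 a0 = delta i0 a1.
    by apply: uniq_coef; rewrite !sum_delta e0 e1 comm_gr.
  by move=> /ffunP /(_ i1); rewrite !ffunE eqxx.
have : delta i0 1 = delta i0 0.
  by apply: uniq_coef; rewrite !sum_delta e0 a00 rmorph0 !mulr0.
by move=> /ffunP /(_ i0); rewrite !ffunE eqxx => /eqP; rewrite oner_eq0.
Qed.

Lemma dim_le1_commutative : (\dim {:D} <= 1)%N -> commutative (@GRing.mul D).
Proof.
move=> dim1; have : (1%VS : {vspace D}) == fullv.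
  by rewrite eqEdim subvf dim_vline oner_neq0.
move=> /eqP e x y; have := memvf x; rewrite -e => /vlineP[k ->].
by rewrite mulr_algl mulr_algr.
Qed.

End GradedLemmas.

(** * Maximal subgroups *)

Section MaximalSubgroups.
Variables (G : orderedZmodType) (K : fieldType) (D : falgType K).
Variable w : valuation G D.
Hypothesis D_division : division_algebra D.
Hypothesis D_noncomm : ~ commutative (@GRing.mul D).
Hypothesis w_nontrivial : exists2 k : K, k != 0 & w k%:A <> Some 0.
Local Notation Du := (unit_group D).
Implicit Types (a m y : Du) (M : set Du).

(** For a common nonzero scalar [t], both [1 + t *: x] and [1 + t *: y] are 1-units, and they
    commute only if [x] and [y] do. *)
Lemma abelian_one_units_commutative :
  ~ (forall x y, one_units w x -> one_units w y -> commute x y).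
Proof.
move=> cU; apply: D_noncomm => x y.
have [t [t0 tx ty]] := scale_val_gt0_pair D_division w_nontrivial x y.
have unit1D z : vlt (Some 0) (w (t *: z)) ->
    exists2 u : Du, one_units w u & val u = 1 + t *: z.
  move=> tz; have u0 : 1 + t *: z != 0.
    by apply/eqP => e; have := val_1D tz; rewrite e val0.
  by exists (division_unit D_division u0); rewrite // /one_units /= [1 + _]addrC addrK.
have [u Uu uE] := unit1D x tx; have [u' Uu' uE'] := unit1D y ty.
have := cU _ _ Uu Uu' => /(congr1 val); rewrite !ug_valM uE uE'.
rewrite !mulrDl !mulrDr !mul1r !mulr1 -!addrA => /addrI.
rewrite [RHS]addrCA => /addrI /addrI.
rewrite -!scalerAl -!scalerAr !scalerA => /(scalerI _); apply.
exact: mulf_neq0.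
Qed.

Lemma abelian_not_maximal M : tame w -> maximal_subgroup M ->
  ~ (M `<=` centralizer M).
Proof.
move=> [rk centerE] maxM abM.
have [UM|DUM] := maximal_subgroup_mul maxM (one_units_subgroup w D_division)
    (fun u m Uu _ => one_units_conj D_division m Uu).
  by apply: abelian_one_units_commutative => x y /UM Mx /UM; exact: abM.
have comm_gr := gr_commutative D_division (fun x y Mx => abM x Mx y) DUM.
apply/D_noncomm/dim_le1_commutative/(gr_rank_le1 comm_gr rk) => z.
by apply/centerE => x; exact: comm_gr.
Qed.

(** Conjugation by [m] has order dividing [r] on the abelian group [L], so a trivial iterated
    commutator makes the power of [[~ y, m]] with exponent [r ^ n] trivial. But [[~ y, m] - 1] has a
    finite value above that of [r]. *)
Lemma scalar_comm_not_nilpotent a m (k : K) y (t : K) r :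
  val [~ a, m]%g = k%:A -> k != 1 -> r.-primitive_root k ->
  t != 0 -> vlt (Some 0) (w (t *: val a)) ->
  vlt (Some 0) (w (t *: (((k - 1) / r%:R) *: val a))) ->
  val y = 1 + t *: val a -> forall n, iter n (fun z => [~ z, m]%g) y <> 1%g.
Proof.
move=> kE k1 prim_k t0 ta tka yE n yn1.
pose L := unit_centralizer [set x | val a * x = x * val a].
have sL : is_subgroup L := unit_centralizer_subgroup _.
have La u : L u -> commute a u.
  by move=> Lu; apply: val_inj; apply/esym/Lu.
have cL u u' : L u -> L u' -> commute u u'.
  move=> Lu /La /(congr1 val) au'; apply: val_inj; exact: Lu.
have nL u : L u -> L (u ^ m)%g by exact: bicentralizer_conj kE.
have cLr u : L u -> commute u (m ^+ r)%g.
  move=> Lu; apply: val_inj; apply: Lu.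
  have ami i : (a ^ (m ^+ i) = a * [~ a, m] ^+ i)%g.
    elim: i => [|i IHi]; first by rewrite conjg1 mulg1.
    rewrite expgSr conjgM IHi conjMg conjXg.
    have /eqP -> : ([~ a, m] ^ m == [~ a, m])%g.
      by rewrite conjg_fix; apply/commgP/(scalar_commute m kE).
    by rewrite -[(a ^ m)%g](mulVKg a) -commgEl -mulgA -expgS.
  suff /(congr1 val) : commute a (m ^+ r)%g by [].
  apply/commgP; rewrite -conjg_fix ami; apply/eqP/val_inj.
  rewrite ug_valM ug_valX kE exprZn expr1n (prim_expr_order prim_k).
  by rewrite scale1r mulr1.
have Ly : L y.
  move=> x ax; rewrite yE mulrDl mulrDr mul1r mulr1.
  by rewrite -scalerAl ax scalerAr.
have := iter_commg_expn_fixed sL cL nL cLr Ly yn1.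
set q := (r ^ n)%N => yq.
have comm_q : ([~ y, m] ^+ q = 1)%g.
  rewrite commgEl expgMn; last by apply: cL; [case: sL => _ _; apply|exact: nL].
  by rewrite expVgn -conjXg yq mulVg.
(* [y ^ m - y] equals [r%:R * z]; as [z] has positive value, the value of this product exceeds that
   of [r%:R]. *)
pose z := t *: (((k - 1) / r%:R) *: val a).
have r0 : r%:R != 0 :> K := prim_root_natf_neq0 prim_k.
have rz : r%:R * z = t *: ((k - 1) *: val a).
  rewrite /z mulr_natl !scalerA -scaler_nat scalerA; congr (_ *: _).
  by rewrite mulrCA [r%:R * _]mulrC divfK.
have commE : val [~ y, m]%g = 1 + (val y)^-1 * (r%:R * z).
  have am : val (a ^ m)%g = k *: val a.
    by rewrite -[(a ^ m)%g](mulVKg a) -commgEl ug_valM kE mulr_algr.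
  have ym : val (y ^ m)%g = val y + r%:R * z.
    rewrite rz scalerBl scale1r scalerBr yE.
    rewrite -addrA subrKC -am conjgE !ug_valM !ug_valV yE.
    rewrite mulrDl mul1r mulrDr mulVr ?ugP // -scalerAl -scalerAr.
    by rewrite mulrA.
  by rewrite commgEl ug_valM ym ug_valV mulrDr mulVr ?ugP.
have wy : w (val y) = Some 0 by rewrite yE val_1D.
have z0 : z != 0.
  rewrite /z !scaler_eq0 (negPf t0) (negPf (ug_neq0 a)) orbF /=.
  by rewrite mulf_eq0 invr_eq0 (negPf r0) orbF subr_eq0.
have [h wz] := val_neq0 w z0.
have r0D : r%:R != 0 :> D by rewrite -[r%:R](rmorph_nat (in_alg D)) fmorph_eq0.
have [rho wr] := val_neq0 w r0D.
have h0 : 0 < h by move: tka; rewrite -/z wz /vlt /= -oz_ltNge.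
have rho0 : 0 <= rho by have := vle0_val_nat w r; rewrite wr.
have wx : w ((val y)^-1 * (r%:R * z)) = Some (rho + h).
  by rewrite !Defs.valM (valV D_division wy) wr wz /= oppr0 add0r.
have rho_lt : rho < rho + h by rewrite -{1}[rho]addr0 oz_ltD2l.
apply: (expn1D_neq1 (s := n) wr wx _ rho_lt); first exact: le_lt_trans rho_lt.
by rewrite -commE -ug_valX comm_q.
Qed.

Lemma maximal_locally_nilpotent_abelian M :
  central_algebra D -> locally_nilpotent M ->
  maximal_subgroup M -> M `<=` centralizer M.
Proof.
move=> cD lnM maxM; apply: contrapT => nab; have [sM _ _] := maxM.
have [a [Ma nca caM]] := locally_nilpotent_second_center D_division sM lnM nab.
have [m /not_implyP[Mm nam]] := (existsNP _).2 nca.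
have scal n : M n -> exists k : K, val [~ a, n]%g = k%:A.
  move=> /caM; exact: (maximal_centralizer_scalar D_division cD maxM Ma nca caM).
have LM := maximal_bicentralizer_sub D_division maxM Mm nam scal.
have [k kE] := scal m Mm.
have k1 : k != 1.
  apply/eqP => k1; apply: nam; apply/commgP/eqP/val_inj.
  by rewrite kE k1 scale1r.
have [N N0 kN] := scalar_comm_finite_order D_division kE.
have [r prim_k _] := prim_order_exists N0 kN.
have [t [t0 ta tka]] := scale_val_gt0_pair D_division w_nontrivial
  (val a) (((k - 1) / r%:R) *: val a).
have y0 : 1 + t *: val a != 0.
  by apply/eqP => e; have := val_1D ta; rewrite e val0.
pose y := division_unit D_division y0.
(* [y] is a polynomial in [a], hence lies in the bicentralizer of [a]. *)
have My : M y.
  apply: LM => x ax; rewrite /= mulrDl mulrDr mul1r mulr1.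
  by rewrite -scalerAl ax scalerAr.
have [|| n Hn] := lnM [set y; m].
- by rewrite finite_setU; split; exact: finite_set1.
- by move=> _ [->|->].
apply: (scalar_comm_not_nilpotent kE k1 prim_k t0 ta tka (erefl (val y)) (n := n)).
have : lower_central (generated [set y; m]) n (iter n (fun z => [~ z, m]%g) y).
  by apply: iter_commg_lower_central; apply: sub_generated; [left|right].
by rewrite Hn.
Qed.

End MaximalSubgroups.

Theorem corollary3p3 (Gamma Delta : orderedZmodType) (K : fieldType)
    (v : valuation Gamma K) (D : falgType K) (w : valuation Delta D)
    (v_henselian : henselian v) (v_nontrivial : nontrivial_valuation v)
    (D_division : division_algebra D) (D_central : central_algebra D)
    (D_noncomm : ~ commutative (@GRing.mul D))
    (w_extends : extends (GRing.in_alg D) v w) (D_tame : tame w) :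
  ~ exists M : set (unit_group D), maximal_subgroup M /\ locally_nilpotent M.
Proof.
(* The order embedding [j] sends only 0 to 0, so [w] inherits nontriviality on [K] from [v]. *)
have w_nontrivial : exists2 k : K, k != 0 & w k%:A <> Some 0.
  have [k k0 vk] := v_nontrivial; have [j [mono_j wE]] := w_extends.
  exists k; first exact/eqP.
  rewrite -[k%:A]/(GRing.in_alg D k) wE.
  case: (v k) vk => //= g g0 [jg0]; apply: g0; congr Some.
  by apply: le_anti; rewrite -!mono_j raddf0 jg0 lexx.
move=> [M [maxM lnM]].
apply: (abelian_not_maximal D_division D_noncomm w_nontrivial D_tame maxM).
exact: (maximal_locally_nilpotent_abelian D_division w_nontrivial D_central
  lnM maxM).
Qed.
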